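(* Let $N\ge2$, $0<s<1$, $1<p<p_c=2N/(N+s)$ and $sp<1$. Let $u$ be a solution of $\partial_tu+\mathcal L_{s,p}u=0$ in $\mathbb R^N\times(0,\infty)$ corresponding to a locally integrable initial datum $u_0\ge0$. If $u$ has finite extinction time $T>0$, then $u(t)$ belongs to the Morrey space $\widetilde M^{q_*}(\mathbb R^N)$, $q_*=N(2-p)/(sp)$, for all $0\le t\le T$. More precisely, the Morrey norm is bounded by $$|||u_0|||_{q_*}\le C\,T^{1/(2-p)},$$ where the constant $C=C(s,p)$ does not depend on $u$ (it may depend on $N$).
   Context: Let $\Phi_p(z)=|z|^{p-2}z$ and $\mathcal L_{s,p}(u)(x)=P.V.\int_{\mathbb R^N}\frac{\Phi_p(u(x)-u(y))}{|x-y|^{N+sp}}\,dy$. In $L^2(\mathbb R^N)$ it is the subdifferential of the convex functional $J(u)=\frac1{2p}\iint\frac{|u(x)-u(y)|^p}{|x-y|^{N+sp}}\,dxdy$; it generates a contraction semigroup $S_t$ which extends to an order-preserving contraction semigroup on every $L^q(\mathbb R^N)$, $1\le q<\infty$; semigroup solutions are $S_tu_0$ with $u_0\in L^q(\mathbb R^N)$. For more general nonnegative $u_0$, the solution is the minimal solution $u=\lim_nu_n$, where $u_n$ are the semigroup solutions with data any nondecreasing sequence $0\le u_{0,n}\in L^1(\mathbb R^N)\cap L^\infty(\mathbb R^N)$ converging monotonically to $u_0$. The extinction time is the first time $T$ such that $u(\cdot,t)\equiv0$ for $t\ge T$ ($T=\infty$ if there is none). For $q>1$ the Morrey space $\widetilde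 M^q(\mathbb R^N)$ is the set of locally integrable $f$ such that $\int_{B_R(x_0)}|f(x)|\,dx\le C\,R^{N(q-1)/q}$ for all $x_0\in\mathbb R^N$, $R>0$, with norm $|||f|||_q$ equal to the infimum of such $C$. *)

(* Defs.v *)
From HB Require Import structures.
From mathcomp Require Import all_boot all_order all_algebra.
From mathcomp Require Import all_classical all_reals all_analysis.
From mathcomp Require Import measurable_realfun.

Set Implicit Arguments.
Unset Strict Implicit.
Unset Printing Implicit Defensive.
Import Order.TTheory GRing.Theory Num.Theory.
Import numFieldNormedType.Exports.

Local Open Scope classical_set_scope.
Local Open Scope ring_scope.

(* R^N is N.-tuple R, which carries the product (Borel) sigma-algebra. Its
   Lebesgue measure is the iterated product lebesgue_measure \x ... ,
   transported along the identification R * R^n = R^(n+1). *)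
Section lebesgue_tuple.
Context {R : realType}.
Local Notation mR := (measurableTypeR R).
Implicit Type n : nat.

Definition tcons n (z : mR * n.-tuple R) : n.+1.-tuple R :=
  [tuple of (z.1 : R) :: z.2].

Definition tuncons n (x : n.+1.-tuple R) : mR * n.-tuple R :=
  (thead x, [tuple of behead x]).

Lemma tconsK n : cancel (@tcons n) (@tuncons n).
Proof. by case=> r t; congr pair; apply/val_inj. Qed.

Lemma measurable_tcons n : measurable_fun [set: mR * n.-tuple R] (@tcons n).
Proof.
have mfst : measurable_fun [set: mR * n.-tuple R] (fst : _ -> R).
  exact: (@measurable_fst _ _ mR (n.-tuple R)).
exact: (measurable_cons mfst measurable_snd).
Qed.

Lemma measurable_tuncons n : measurable_fun [set: n.+1.-tuple R] (@tuncons n).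
Proof.
have mhead : measurable_fun [set: n.+1.-tuple R] (@thead n R : _ -> mR).
  exact: (@measurable_tnth _ R n.+1 ord0).
exact: (@measurable_fun_pair _ _ _ (n.+1.-tuple R) mR (n.-tuple R)
  (fun x => thead x) (fun x => [tuple of behead x])
  mhead (@measurable_behead _ R n)).
Qed.

Section step.
Context n (m : {sigma_finite_measure set (n.-tuple R) -> \bar R}).

Definition leb_step : set (n.+1.-tuple R) -> \bar R :=
  pushforward (@lebesgue_measure R \x m)%E (@tcons n).

Let preimage_tcons_measurable A : measurable A ->
  measurable (@tcons n @^-1` A).
Proof.
by move=> mA; rewrite -[X in measurable X]setTI; exact: measurable_tcons.
Qed.

Let leb_step0 : leb_step set0 = 0%E.
Proof. by rewrite /leb_step /pushforward preimage_set0 measure0. Qed.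

Let leb_step_ge0 A : (0 <= leb_step A)%E.
Proof. exact: (measure_ge0 (@lebesgue_measure R \x m)%E). Qed.

Let leb_step_sigma_additive : semi_sigma_additive leb_step.
Proof.
move=> F mF tF mUF; rewrite /leb_step /pushforward preimage_bigcup.
apply: measure_semi_sigma_additive.
- by move=> i; exact: preimage_tcons_measurable.
- by move=> i j _ _ [z [Fiz Fjz]]; apply: (tF i j) => //; exists (tcons z).
- by rewrite -preimage_bigcup; exact: preimage_tcons_measurable.
Qed.

HB.instance Definition _ := isMeasure.Build _ _ _ leb_step
  leb_step0 leb_step_ge0 leb_step_sigma_additive.

Let leb_step_sigma_finite : sigma_finite setT leb_step.
Proof.
have /sigma_finiteP[F [TF ndF Foo]] := sigma_finiteT (@lebesgue_measure R).
have /sigma_finiteP[G [TG ndG Goo]] := sigma_finiteT m.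
exists (fun i => @tuncons n @^-1` (F i `*` G i)).
  apply/seteqP; split=> // x _.
  have [i _ Fi] : (\bigcup_i F i) (tuncons x).1 by rewrite -TF.
  have [j _ Gj] : (\bigcup_i G i) (tuncons x).2 by rewrite -TG.
  exists (maxn i j) => //; split.
    by move: Fi; exact/subsetPset/ndF/leq_maxl.
  by move: Gj; exact/subsetPset/ndG/leq_maxr.
move=> i; have [mF Fi] := Foo i; have [mG Gi] := Goo i; split.
  rewrite -[X in measurable X]setTI; apply: measurable_tuncons => //.
  exact: measurableX.
rewrite /leb_step /pushforward -comp_preimage.
rewrite (_ : _ \o _ = id); last by apply/funext => z /=; rewrite tconsK.
rewrite preimage_id product_measure1E//.
by rewrite lte_mul_pinfty// ge0_fin_numE.
Qed.

HB.instance Definition _ := Measure_isSigmaFinite.Build _ _ _ leb_step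
  leb_step_sigma_finite.

End step.

Fixpoint leb n : {sigma_finite_measure set (n.-tuple R) -> \bar R} :=
  match n with
  | 0%N => \d_ [tuple]
  | n'.+1 => leb_step (leb n')
  end.

Lemma leb_box n (A : 'I_n -> set R) : (forall i, measurable (A i)) ->
  leb n [set x | forall i, A i (tnth x i)] =
  (\prod_(i < n) @lebesgue_measure R (A i))%E.
Proof.
elim: n A => [|n IHn] A mA.
  by rewrite big_ord0 /= diracE mem_set// => -[].
rewrite big_ord_recl -(IHn (fun i => A (lift ord0 i)))//.
rewrite /= /leb_step /pushforward /=.
rewrite -product_measure1E//; last first.
  rewrite (_ : [set _ | _] = \bigcap_(i in [set: 'I_n])
      ((fun x : n.-tuple R => tnth x i) @^-1` A (lift ord0 i))).
    apply: fin_bigcap_measurable => // i _.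
    by rewrite -[X in measurable X]setTI; exact: measurable_tnth.
  by apply/seteqP; split=> x /= xA i => [_|]; exact: xA.
  exact: mA.
apply: (congr1 (product_measure1 _ _)); apply/seteqP; split=> -[r x] /=.
  move=> xA; split; first exact: (xA ord0).
  by move=> i; have := xA (lift ord0 i); rewrite tnthS.
move=> [rA xA] i; case: (unliftP ord0 i) => [j ->|->]; last by rewrite tnth0.
by rewrite tnthS; exact: xA.
Qed.

End lebesgue_tuple.

Section fractional_p_laplacian.
Context {R : realType} {N : nat}.
Local Notation E := (N.-tuple R).
Local Notation mu := (@leb R N).
Implicit Types (s p q r t : R) (f g v : E -> R).

Definition eucl_dist (x y : E) : R :=
  Num.sqrt (\sum_(i < N) (tnth x i - tnth y i) ^+ 2).

Definition eucl_ball (x0 : E) r : set E := [set x | eucl_dist x0 x < r].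

Definition norm2 f : \bar R := 'N[mu]_2%:E[EFin \o f]%E.

(* J; on the (null) diagonal x = y the integrand is 0. *)
Definition energy s p f : \bar R :=
  (((2 * p)^-1)%:E *
   \int[mu]_x \int[mu]_y
     (`|f x - f y| `^ p / eucl_dist x y `^ (N%:R + s * p))%:E)%E.

(* g \in dJ(f), the subdifferential being taken in L^2(R^N). Since J is proper,
   this forces J(f) < +oo. The operator L_{s,p} is, in L^2(R^N), dJ. *)
Definition subdifferential s p f g : Prop :=
  [/\ f \in Lfun mu 2%:E, g \in Lfun mu 2%:E &
    forall v, v \in Lfun mu 2%:E ->
      (energy s p f + \int[mu]_x (g x * (v x - f x))%:E <= energy s p v)%E].

(* g is the derivative of u at t, as a curve in L^2(R^N). *)
Definition L2_derivative (u : R -> E -> R) t g : Prop :=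
  norm2 (fun x => (u (t + h) x - u t x) / h - g x) @[h --> 0^'] --> 0%E.

(* w t = S_t v for v \in L^2(R^N): the semigroup generated by dJ, in the sense of
   Brezis and Komura. The curve w is continuous from [0, +oo[ to L^2(R^N),
   Lipschitz on [delta, +oo[ for every delta > 0, and solves the inclusion
   w' + dJ(w) \ni 0 almost everywhere. *)
Definition L2_semigroup s p v (w : R -> E -> R) : Prop :=
  [/\ w 0 = v %[ae mu],
      forall t, 0 <= t -> w t \in Lfun mu 2%:E,
      forall t0, 0 <= t0 ->
        norm2 (w t \- w t0) @[t --> within `[0, +oo[ (nbhs t0)] --> 0%E,
      forall delta : R, 0 < delta -> exists K : R, forall t1 t2,
        delta <= t1 -> delta <= t2 ->
        (norm2 (w t1 \- w t2)%R <= (K * `|t1 - t2|)%:E)%E &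
      {ae @lebesgue_measure R, forall t, 0 < t ->
        exists g, L2_derivative w t g /\ subdifferential s p (w t) (\- g)}].

Definition nonneg_L1_Loo v : Prop :=
  [/\ {ae mu, forall x, 0 <= v x}, v \in Lfun mu 1 & v \in Lfun mu +oo%E].

(* u t = S_t u0 for 0 <= u0 \in L^q(R^N): the continuous extension of S_t to
   L^q(R^N), obtained from the bounded integrable data, which are dense in the
   nonnegative cone of L^q(R^N). *)
Definition Lq_solution s p q (u0 : E -> R) (u : R -> E -> \bar R) : Prop :=
  u0 \in Lfun mu q%:E /\
  exists (v : nat -> E -> R) (w : nat -> R -> E -> R),
    [/\ forall n, nonneg_L1_Loo (v n),
        forall n, L2_semigroup s p (v n) (w n),
        'N[mu]_q%:E[EFin \o (v n \- u0)%R]%E @[n --> \oo] --> 0%E &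
        forall t, 0 <= t ->
          'N[mu]_q%:E[(EFin \o w n t) \- u t]%E @[n --> \oo] --> 0%E].

(* u = lim_n S_t v_n, where 0 <= v_n is bounded, integrable and converges
   monotonically to u0. *)
Definition minimal_solution s p (u0 : E -> R) (u : R -> E -> \bar R) : Prop :=
  exists (v : nat -> E -> R) (w : nat -> R -> E -> R),
    [/\ forall n, nonneg_L1_Loo (v n),
        {ae mu, forall x, {homo v ^~ x : m n / (m <= n)%N >-> m <= n}},
        {ae mu, forall x, v n x @[n --> \oo] --> u0 x},
        forall n, L2_semigroup s p (v n) (w n) &
        forall t, 0 <= t ->
          {ae mu, forall x, (w n t x)%:E @[n --> \oo] --> u t x}].

(* The functions u t are taken extended-real valued, since they may be monotone
   limits. *)
Definition solution s p (u0 : E -> R) (u : R -> E -> \bar R) : Prop :=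
  (forall t, 0 <= t -> measurable_fun [set: E] (u t)) /\
  ((exists2 q, 1 <= q & Lq_solution s p q u0 u) \/ minimal_solution s p u0 u).

(* T is the first time such that u t vanishes for all t >= T. *)
Definition extinction_time (u : R -> E -> \bar R) (T : R) : Prop :=
  let vanishing := [set T' | 0 <= T' /\
    forall t, T' <= t -> u t = cst 0%E %[ae mu]] in
  vanishing T /\ lbound vanishing T.

(* Balls exhaust the compact sets of R^N. *)
Definition loc_integrable (f : E -> \bar R) : Prop :=
  measurable_fun [set: E] f /\
  forall x0 r, 0 < r -> mu.-integrable (eucl_ball x0 r) f.

Definition morrey_bound q (f : E -> \bar R) : set R :=
  [set C | forall x0 r, 0 < r ->
    (\int[mu]_(x in eucl_ball x0 r) `|f x| <= (C * r `^ (N%:R * (q - 1) / q))%:E)%E].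

Definition morrey_space q : set (E -> \bar R) :=
  [set f | loc_integrable f /\ morrey_bound q f !=set0].

Definition morrey_norm q (f : E -> \bar R) : \bar R :=
  ereal_inf (EFin @` morrey_bound q f).

End fractional_p_laplacian.

(* Main.v *)
Require Import Defs.
From HB Require Import structures.
From mathcomp Require Import all_boot all_order all_algebra.
From mathcomp Require Import all_classical all_reals all_analysis.
From mathcomp Require Import measurable_realfun.
From mathcomp Require Import ring lra.
Set Implicit Arguments.
Unset Strict Implicit.
Unset Printing Implicit Defensive.
Import Order.TTheory GRing.Theory Num.Theory.
Import numFieldNormedType.Exports.
Local Open Scope classical_set_scope.
Local Open Scope ring_scope.

(** Write [sigma = s * p]. The mass of a solution on a ball is estimated through
    its pairing with the weight [phi x = (r + |x - x0|) `^ (- (N + sigma))], for the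
    l1 distance to [x0], whose decay is that of the kernel of the operator. As
    [sigma < 1] and [phi] is Lipschitz, the integral in [y] of
    [|phi x - phi y| / |x - y| `^ (N + sigma)] converges absolutely, and it is at
    most [C * r `^ (- sigma) * phi x] (lemma [test_fun_nonlocal_le]). Since
    [p - 1 < 1], the power [p - 1] of an increment of [u] is at most the sum of the
    powers at its two ends, so that [X t], the integral of [u t * phi], satisfies
    [X' >= - C * r `^ (- sigma) * (integral of u `^ (p - 1) * phi)]. The right-hand
    side is sublinear in [u], hence a solution that vanishes at time [T] has an
    initial mass [X 0] of order [T `^ (1 / (2 - p))]. Bounding [phi] from below on
    the ball of radius [r] gives the Morrey estimate, with the power of [r] that
    scaling dictates (lemma [weighted_bound_scaling]).

    The differential inequality is not integrated as a nonlinear one. For every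
    level [l > 0] one has [u `^ (p - 1) <= l `^ (p - 2) * u + l `^ (p - 1)]; the
    level for which the resulting linear rate is [1 / (2 T)] lets the supremum of
    [X] absorb the loss (lemma [L2_curve_backward_bound]), and that level is
    proportional to [(r `^ (- sigma) * T) `^ (1 / (2 - p))].

    Orbits of the semigroup solve the equation only as a differential inclusion in
    [L^2], almost everywhere in time. The weak form is therefore extracted from
    the subgradient inequality by perturbing along [phi]
    (lemma [subdifferential_pairing_le]), and inequalities between derivatives are
    integrated for curves that are Lipschitz away from time zero
    (lemma [lipschitz_ae_increment_le]). Positivity and order preservation follow
    from the submodularity of the energy (lemma [L2_semigroup_comparison]).

    For a minimal solution every approximating orbit lies below the limit, so it
    is extinct at time [T] too, and the bound passes to the limit by Fatou's
    lemma. For a solution in [L^q] the weighted masses converge, because [phi] is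
    bounded and integrable. *)

(** * Inequalities for real powers *)

Section powR_inequalities.
Context {R : realType}.
Implicit Types a b c d x y u v w l h p q t : R.

Lemma powR_rescale w l q : 0 <= w -> 0 < l -> w `^ q = l `^ q * (w / l) `^ q.
Proof.
move=> w0 l0; rewrite -powRM; [by rewrite mulrC divfK ?gt_eqF|exact: ltW|].
by rewrite divr_ge0// ltW.
Qed.

Lemma powR_subadd x y q : 0 <= x -> 0 <= y -> 0 <= q <= 1 ->
  (x + y) `^ q <= x `^ q + y `^ q.
Proof.
move=> x0 y0 /andP[q0 q1].
have [xy0|xy0] := leP (x + y) 0.
  have -> : x = 0 by lra.
  by rewrite add0r lerDr powR_ge0.
have part z : 0 <= z -> z <= x + y -> (x + y) `^ q * (z / (x + y)) <= z `^ q.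
  rewrite le_eqVlt => /predU1P[<- _|z0 zxy]; first by rewrite mul0r mulr0 powR_ge0.
  rewrite (powR_rescale _ (ltW z0) xy0) ler_pM2l ?powR_gt0//.
  by apply: ger1_powR; rewrite // divr_gt0//= ler_pdivrMr// mul1r.
have -> : (x + y) `^ q =
    (x + y) `^ q * (x / (x + y)) + (x + y) `^ q * (y / (x + y)).
  by rewrite -mulrDr -mulrDl divff ?mulr1// gt_eqF.
by apply: lerD; apply: part => //; lra.
Qed.

(** The power is linearised at a level [l] that remains free, to be tuned when a
    differential inequality with this power is integrated. *)
Lemma powR_le_affine w l q : 0 <= w -> 0 < l -> 0 <= q <= 1 ->
  w `^ q <= l `^ (q - 1) * w + l `^ q.
Proof.
move=> w0 l0 /andP[q0 q1].
have [wl|lw] := leP w l.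
  have := @ge0_ler_powR _ q q0 w l; rewrite !nnegrE => /(_ w0 (ltW l0) wl).
  by move=> /le_trans; apply; rewrite lerDr mulr_ge0 ?powR_ge0.
rewrite (powR_rescale _ w0 l0).
have : (w / l) `^ q <= w / l by apply: ler1_powR; rewrite // ler_pdivlMr// mul1r ltW.
rewrite -(ler_pM2l (powR_gt0 q l0)) => /le_trans; apply.
rewrite powRB ?(gt_eqF l0) ?implybT// powRr1 ?(ltW l0)//.
have := powR_ge0 l q.
rewrite (_ : l `^ q * (w / l) = l `^ q / l * w); last by rewrite mulrA mulrAC.
lra.
Qed.

Lemma powR_increment_le x y p : 0 <= y -> y <= x -> 1 < p <= 2 ->
  x `^ p - y `^ p <= 2 * (x - y) * x `^ (p - 1).
Proof.
move=> y0 yx /andP[p1 p2].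
have x0 : 0 <= x by exact: le_trans yx.
have p0 : 0 < p by lra.
rewrite -(mulr_powRB1 x0 p0) -(mulr_powRB1 y0 p0).
have mono : y `^ (p - 1) <= x `^ (p - 1).
  by apply: ge0_ler_powR; rewrite ?nnegrE //; lra.
suff cross : y * x `^ (p - 1) <= x * y `^ (p - 1).
  have : (x - y) * y `^ (p - 1) <= (x - y) * x `^ (p - 1).
    by apply: ler_wpM2l => //; lra.
  rewrite !mulrBl; nra.
move: y0; rewrite le_eqVlt => /predU1P[<-|y0].
  by rewrite mul0r mulr_ge0 ?powR_ge0.
rewrite (powR_rescale _ x0 y0).
have : (x / y) `^ (p - 1) <= x / y.
  by apply: ler1_powR; rewrite ?ler_pdivlMr ?mul1r//; lra.
rewrite -(ler_pM2l (powR_gt0 (p - 1) y0)) -(ler_pM2l y0) => /le_trans; apply.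
by rewrite le_eqVlt; apply/orP; left; apply/eqP; field; lra.
Qed.

(** Since [p - 1 < 1], the derivative of the [p]-th power is subadditive up to a
    constant, which separates the slope at [a] from a remainder of order
    [h `^ p]. *)
Lemma norm_powR_perturb a b h p : 0 < h -> 1 < p <= 2 ->
  `|a + h * b| `^ p <= `|a| `^ p +
    2 * h * (`|b| * `|a| `^ (p - 1) + h `^ (p - 1) * `|b| `^ p).
Proof.
move=> h0 /andP[p1 p2].
have hb0 : 0 <= h * `|b| by rewrite mulr_ge0// ltW.
apply: (@le_trans _ _ ((`|a| + h * `|b|) `^ p)).
  apply: ge0_ler_powR; rewrite ?nnegrE ?addr_ge0//; first lra.
  by rewrite (le_trans (ler_normD _ _))// normrM (gtr0_norm h0).
have : `|a| <= `|a| + h * `|b| by rewrite lerDl.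
have p12 : 1 < p <= 2 by rewrite p1.
move=> /(powR_increment_le (normr_ge0 a)) /(_ p12).
have : (`|a| + h * `|b|) `^ (p - 1) <= `|a| `^ (p - 1) + (h * `|b|) `^ (p - 1).
  by apply: powR_subadd => //; lra.
rewrite (powRM _ (ltW h0))// => sub.
rewrite -(mulr_powRB1 (normr_ge0 b)); last lra.
set A := `|a| `^ (p - 1) in sub *; set B := `|b| `^ (p - 1) in sub *.
set H := h `^ (p - 1) in sub *; set S := (_ + _) `^ (p - 1) in sub *.
have : h * `|b| * S <= h * `|b| * (A + H * B) by exact: ler_wpM2l.
lra.
Qed.

Lemma norm_powR_convex t x y p : 0 <= t <= 1 -> 1 <= p ->
  `|t * x + (1 - t) * y| `^ p <= t * `|x| `^ p + (1 - t) * `|y| `^ p.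
Proof.
move=> /andP[t0 t1] p1.
apply: (@le_trans _ _ ((t * `|x| + (1 - t) * `|y|) `^ p)).
  have t1' : 0 <= 1 - t by lra.
  have p0 : 0 <= p by lra.
  apply: ge0_ler_powR => //; first by rewrite nnegrE addr_ge0// mulr_ge0.
  by rewrite (le_trans (ler_normD _ _))// !normrM (ger0_norm t0) (ger0_norm t1').
by apply: (convex_powR p1 (Itv01 t0 t1)); rewrite inE/= in_itv/= normr_ge0.
Qed.

Lemma norm_powR_exchange x y u v p : 1 <= p ->
  x <= u <= y -> u + v = x + y ->
  `|u| `^ p + `|v| `^ p <= `|x| `^ p + `|y| `^ p.
Proof.
move=> p1 /andP[xu uy] uv.
have [xy|xy] := leP y x.
  have -> : u = x by lra.
  by have -> : v = y by lra.
pose t := (y - u) / (y - x).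
have t01 : 0 <= t <= 1 by rewrite /t divr_ge0/= ?ler_pdivrMr; lra.
have t01' : 0 <= 1 - t <= 1 by lra.
have := norm_powR_convex x y t01 p1; have := norm_powR_convex x y t01' p1.
have -> : (1 - t) * x + (1 - (1 - t)) * y = v.
  have -> : v = x + y - u by lra.
  by rewrite /t; field; lra.
have -> : t * x + (1 - t) * y = u by rewrite /t; field; lra.
lra.
Qed.

(** Replacing two functions by their minimum and maximum can only bring the
    increments closer together, so a convex function of the increments
    decreases. *)
Lemma norm_powR_min_max a b c d p : 1 <= p ->
  `|Num.min a b - Num.min c d| `^ p + `|Num.max a b - Num.max c d| `^ p <=
  `|a - c| `^ p + `|b - d| `^ p.
Proof.
move=> p1; case: (leP a b) => ab; case: (leP c d) => cd; rewrite ?lexx//.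
- by apply: norm_powR_exchange => //; lra.
- by rewrite [leRHS]addrC; apply: norm_powR_exchange => //; lra.
- by rewrite addrC.
Qed.

Lemma powRN_lipschitz u v c a (n : nat) : 0 < c -> c <= u -> c <= v ->
  0 <= a <= n%:R ->
  `|u `^ (- a) - v `^ (- a)| <= n%:R * c `^ (- a - 1) * `|u - v|.
Proof.
move=> c0; wlog uv : u v / u <= v => [wl cu cv an|].
  have [uv|vu] := leP u v; first exact: wl.
  by rewrite distrC [X in _ * X]distrC; apply: wl; rewrite // ltW.
move=> cu cv /andP[a0 an].
have u0 : 0 < u by lra. have v0 : 0 < v by lra.
pose z := u / v; have z0 : 0 < z by exact: divr_gt0.
have z1 : z <= 1 by rewrite ler_pdivrMr// mul1r.
have -> : v `^ (- a) = u `^ (- a) * z `^ a.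
  rewrite /z powRM ?invr_ge0 ?ltW// mulrA -powRD ?(gt_eqF u0) ?implybT//.
  by rewrite addNr powRr0 mul1r -powR_inv1 ?ltW// -powRrM mulN1r.
(* Bernoulli's inequality is available after passing to an integer exponent. *)
have zn : z ^+ n <= z `^ a.
  by rewrite -powR_mulrn ?(ltW z0)//; apply: ger_powR; rewrite // z0.
have bern : 1 - z ^+ n <= n%:R * (1 - z).
  elim: (n) => [|k IH]; first by rewrite expr0; lra.
  rewrite exprS -natr1 mulrDl mul1r.
  have : z ^+ k <= 1 by apply: exprn_ile1; rewrite // ltW.
  have : 0 <= z ^+ k by rewrite exprn_ge0// ltW.
  nra.
have ua : u `^ (- a) <= c `^ (- a).
  rewrite !powRN lef_pV2 ?posrE ?powR_gt0//.
  by apply: ge0_ler_powR; rewrite ?nnegrE //; lra.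
have zc : 1 - z <= (v - u) / c.
  rewrite (_ : 1 - z = (v - u) / v); last by rewrite /z; field; lra.
  by rewrite ler_wpM2l ?subr_ge0// lef_pV2 ?posrE.
rewrite -{1}[u `^ (- a)]mulr1 -mulrBr normrM (ger0_norm (powR_ge0 _ _)).
have -> : `|u - v| = v - u by rewrite distrC ger0_norm// subr_ge0.
have za0 : 0 <= 1 - z `^ a.
  by rewrite subr_ge0 -(powRr0 z); apply: ger_powR; rewrite // z0.
rewrite (ger0_norm za0) powRB ?(gt_eqF c0) ?implybT// powRr1 ?(ltW c0)//.
rewrite (_ : _ * _ * _ = c `^ (- a) * (n%:R * ((v - u) / c))); last first.
  by field; lra.
apply: ler_pM; rewrite ?powR_ge0//.
apply: (@le_trans _ _ (1 - z ^+ n)); first by rewrite lerD2l lerN2.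
by rewrite (le_trans bern)// ler_wpM2l.
Qed.

End powR_inequalities.

(** * Monotonicity from one-sided increments *)

Section right_increments.
Context {R : realType}.
Implicit Types (f g : R -> R) (a b t x y h d e K L : R).

Definition lipschitz_on a b K f : Prop :=
  forall x y, a <= x -> x <= y -> y <= b -> `|f y - f x| <= K * (y - x).

(** The bound [g <= g a] persists up to a largest time by continuity, and the
    local hypothesis pushes it beyond any time before [b]. *)
Lemma right_decreasing_le g a b K : a <= b -> lipschitz_on a b K g ->
  (forall t, a <= t < b ->
    exists2 d, 0 < d & forall h, 0 < h < d -> g (t + h) <= g t) ->
  g b <= g a.
Proof.
move=> ab glip gdec.
pose S := [set t | a <= t <= b /\ forall x, a <= x <= t -> g x <= g a].
have Sa : S a.
  split; first by rewrite lexx.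
  by move=> x /andP[ax xa]; rewrite (_ : x = a)//; lra.
have Sub : ubound S b by move=> t [/andP[]].
have supS : has_sup S by split; [exists a|exists b].
pose c := sup S.
have ac : a <= c by apply: (sup_upper_bound supS).
have cb : c <= b by apply: ge_sup => //; exists a.
have below x : a <= x -> x < c -> g x <= g a.
  move=> ax xc; have [t [_ tS] xt] := sup_gt (proj1 supS) xc.
  by apply: tS; rewrite ax ltW.
have gc : g c <= g a.
  rewrite leNgt; apply/negP => gac.
  have [ca|ca] := leP c a.
    by move: gac; rewrite (_ : c = a) ?ltxx//; lra.
  pose D := g c - g a; pose K1 := `|K| + 1.
  have D0 : 0 < D by rewrite /D; lra.
  have K10 : 0 < K1 by rewrite /K1; have := normr_ge0 K; lra.
  pose x := Num.max a (c - D / (2 * K1)).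
  have D2 : 0 < D / (2 * K1) by rewrite divr_gt0//; lra.
  have ax : a <= x by rewrite le_max lexx.
  have xc : x < c by rewrite gt_max ca/=; lra.
  have cx : c - x <= D / (2 * K1).
    have : c - D / (2 * K1) <= x by rewrite le_max lexx orbT.
    lra.
  have gx := below x ax xc.
  have gcx : g c - g x <= K1 * (c - x).
    apply: (le_trans (ler_norm _)); apply: (le_trans (glip _ _ ax (ltW xc) cb)).
    apply: ler_wpM2r; first lra.
    by rewrite /K1; have := ler_norm K; lra.
  have : K1 * (c - x) <= K1 * (D / (2 * K1)) by rewrite ler_pM2l.
  rewrite (_ : K1 * (D / (2 * K1)) = D / 2); last by field; lra.
  rewrite /D in gcx *; lra.
have [bc|cb'] := leP b c; first by rewrite (_ : b = c)//; lra.
have [|d d0 hd] := gdec c; first by rewrite ac.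
pose k := Num.min d (b - c) / 2.
have md : Num.min d (b - c) <= d by rewrite ge_min lexx.
have mb : Num.min d (b - c) <= b - c by rewrite ge_min lexx orbT.
have m0 : 0 < Num.min d (b - c) by rewrite lt_min d0/=; lra.
have Sck : S (c + k).
  split; first by rewrite /k; apply/andP; split; lra.
  move=> x /andP[ax xk]; have [xc|xc|->//] := ltgtP x c; first exact: below.
  rewrite (_ : x = c + (x - c)); last by lra.
  by apply: le_trans gc; apply: hd; rewrite /k in xk; apply/andP; split; lra.
have : c + k <= c by apply: (sup_upper_bound supS).
by rewrite /k; lra.
Qed.

(** A Lipschitz function whose right increments are at most [L * h] off a null
    set grows at rate at most [L]. The exceptional null set is covered by an open
    set [U] of small measure, and a multiple of the measure of [U] to the left of
    [t] is subtracted: inside [U] this correction decreases fast enough to beat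
    the Lipschitz constant, and its total variation is small. *)
Lemma lipschitz_ae_increment_le f a b K L : a <= b -> lipschitz_on a b K f ->
  {ae @lebesgue_measure R, forall t, a <= t < b -> forall e, 0 < e ->
    exists2 d, 0 < d & forall h, 0 < h < d -> f (t + h) - f t <= (L + e) * h} ->
  f b - f a <= L * (b - a).
Proof.
move=> ab flip [A [mA A0 subA]].
pose K1 := `|K| + `|L|.
have K10 : 0 <= K1 by rewrite addr_ge0.
suff main e : 0 < e -> f b - f a <= L * (b - a) + (K1 + (b - a)) * e.
  apply/ler_addgt0Pr => e e0.
  have D0 : 0 < K1 + (b - a) + 1 by lra.
  apply: (le_trans (main (e / (K1 + (b - a) + 1)) _)); first exact: divr_gt0.
  rewrite lerD2l mulrCA -[leRHS]mulr1 ler_pM2l// ler_pdivrMr//; lra.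
move=> e0.
have mA' : (@lebesgue_measure R A < +oo)%E by rewrite A0.
have [U [oU AU muU]] := lebesgue_regularity_outer mA mA' e0.
have mU : measurable U by exact: open_measurable.
have Ue : (lebesgue_measure U < e%:E)%E.
  rewrite (measureDI (@lebesgue_measure R) mU mA).
  by rewrite [X in (_ + X)%E](_ : _ = 0%E) ?adde0// setIidr.
have mUI (i : interval R) : measurable (U `&` [set` i]) by exact: measurableI.
have leM (B C : set R) : measurable B -> measurable C -> B `<=` C ->
    (lebesgue_measure B <= lebesgue_measure C)%E.
  move=> mB mC BC.
  by have := @le_measure _ _ _ (@lebesgue_measure R) B C; rewrite !inE; apply.
have finH (i : interval R) : lebesgue_measure (U `&` [set` i]) \is a fin_num.
  rewrite ge0_fin_numE//; apply: le_lt_trans (lt_trans Ue (ltry e)).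
  by apply: leM => //; exact: subIsetl.
pose k t : R := fine (lebesgue_measure (U `&` `]a, t])).
have kD t u : a <= t -> t <= u ->
    k u = k t + fine (lebesgue_measure (U `&` `]t, u])).
  move=> at_ tu; rewrite -fineD//; congr fine.
  have dis : U `&` `]a, t] `&` (U `&` `]t, u]) = set0.
    apply/seteqP; split => // x [[_ /=]] /[swap] -[_ /=].
    by rewrite !in_itv/=; lra.
  rewrite -(measureU (@lebesgue_measure R) (mUI _) (mUI _) dis) -setIUr.
  by rewrite -(@itv_bndbnd_setU _ _ (BRight a) (BRight t) (BRight u)).
have kinc t u : a <= t -> t <= u -> 0 <= k u - k t <= u - t.
  move=> at_ tu; rewrite (kD _ _ at_ tu) addrC addKr fine_ge0//=.
  rewrite -lee_fin fineK//.
  apply: (@le_trans _ _ (@lebesgue_measure R `]t, u])).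
    by apply: leM => //; exact: subIsetr.
  rewrite lebesgue_measure_itv/= lte_fin.
  by case: ifP => [_|]; rewrite ?EFinB// lee_fin; lra.
pose g t := f t - K1 * k t - (L + e) * t.
have : g b <= g a.
  apply: (@right_decreasing_le _ _ _ (`|K| + K1 + `|L + e|)) => //.
    move=> x y ax xy yb.
    rewrite (_ : g y - g x =
      (f y - f x) - K1 * (k y - k x) - (L + e) * (y - x)); last by rewrite /g; ring.
    have /andP[k0 k1] := kinc _ _ ax xy.
    have xy0 : 0 <= y - x by lra.
    rewrite [leRHS](_ : _ = `|K| * (y - x) + K1 * (y - x) + `|L + e| * (y - x));
      last by ring.
    apply: (le_trans (ler_normB _ _)); apply: lerD.
      apply: (le_trans (ler_normB _ _)); apply: lerD.
        apply: (le_trans (flip _ _ ax xy yb)); apply: ler_wpM2r => //.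
        exact: ler_norm.
      by rewrite normrM (ger0_norm K10) (ger0_norm k0); exact: ler_wpM2l.
    by rewrite normrM (ger0_norm xy0).
  move=> t /andP[at_ tb].
  have [At|nAt] := pselect (A t).
    have [d /= d0 dU] : exists2 d, 0 < d & forall z, `|t - z| < d -> U z.
      by have := oU _ (AU _ At) => /nbhs_ballP[d /= d0 dU]; exists d.
    exists (Num.min d (b - t)); first by rewrite lt_min d0 subr_gt0.
    move=> h /andP[h0]; rewrite lt_min => /andP[hd hb].
    have th : t <= t + h by lra.
    have -> : g (t + h) = g t + (f (t + h) - f t) - K1 * (k (t + h) - k t)
      - (L + e) * h by rewrite /g; ring.
    have -> : k (t + h) - k t = h.
      rewrite (kD _ _ at_ th) addrC addKr setIidr; last first.
        move=> z /=; rewrite in_itv/= => /andP[tz zh]; apply: dU.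
        by rewrite distrC ger0_norm; lra.
      rewrite lebesgue_measure_itv/= lte_fin ltrDl h0 -EFinD/=; lra.
    have thb : t + h <= b by lra.
    have := le_trans (ler_norm _) (flip _ _ at_ th thb).
    rewrite (_ : t + h - t = h); last by ring.
    have : K * h <= `|K| * h by apply: ler_wpM2r (ler_norm K); exact: ltW.
    have : - L * h <= `|L| * h.
      by rewrite -normrN; apply: ler_wpM2r (ler_norm (- L)); exact: ltW.
    have : 0 <= e * h by rewrite mulr_ge0// ltW.
    rewrite /K1; lra.
  have [d d0 hd] : exists2 d, 0 < d &
      forall h, 0 < h < d -> f (t + h) - f t <= (L + e) * h.
    apply: contrapT => nt; apply: nAt; apply: subA => /= st; apply: nt.
    by apply: st; rewrite ?at_.
  exists d => // h /[dup] /hd fh /andP[h0 _].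
  have th : t <= t + h by lra.
  have /andP[k0 _] := kinc _ _ at_ th.
  have -> : g (t + h) = g t + (f (t + h) - f t) - K1 * (k (t + h) - k t)
      - (L + e) * h by rewrite /g; ring.
  have : 0 <= K1 * (k (t + h) - k t) by exact: mulr_ge0.
  lra.
have : k b - k a <= e.
  rewrite (kD _ _ (lexx a) ab) addrC addKr -lee_fin fineK// ltW//.
  apply: le_lt_trans Ue.
  by apply: leM => //; exact: subIsetl.
move=> /(ler_wpM2l K10); rewrite /g; lra.
Qed.

End right_increments.

(** * Square-integrable functions *)

Section square_integrable.
Context d (T : measurableType d) (R : realType).
Variable mu : {measure set T -> \bar R}.
Implicit Types (f g : T -> R) (a : R).
Local Notation L2 := (Lfun mu 2%:E).

Let two_ge1 : (1 <= 2%:E :> \bar R)%E. Proof. by rewrite lee_fin ler1n. Qed.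

Definition l2norm f : R := fine ('N[mu]_2%:E[EFin \o f])%E.

Lemma L2_measurable f : f \in L2 -> measurable_fun setT f.
Proof. by move=> /andP[]; rewrite inE. Qed.

Lemma L2D f g : f \in L2 -> g \in L2 -> (fun x => f x + g x) \in L2.
Proof. by move=> fL gL; have [_] := @Lfun_addr_closed _ T R mu _ two_ge1; exact. Qed.

Lemma L2N f : f \in L2 -> (fun x => - f x) \in L2.
Proof. exact: (@Lfun_oppr_closed _ T R mu 2%:E). Qed.

Lemma L2B f g : f \in L2 -> g \in L2 -> (fun x => f x - g x) \in L2.
Proof. by move=> fL gL; apply: L2D => //; exact: L2N. Qed.

Lemma L2Z a f : f \in L2 -> (fun x => a * f x) \in L2.
Proof.
move=> fL; rewrite (_ : (fun x => a * f x) = a \o* f).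
  by apply: Lfun_scale => //; rewrite ler1n.
by apply/funext => x /=; rewrite mulrC.
Qed.

Lemma L2norm_fin f : f \in L2 -> ('N[mu]_2%:E[EFin \o f])%E = (l2norm f)%:E.
Proof.
move=> /andP[_]; rewrite inE/= /finite_norm => fin.
by rewrite fineK// ge0_fin_numE// Lnorm_ge0.
Qed.

Lemma l2norm_ge0 f : 0 <= l2norm f.
Proof. by rewrite fine_ge0// Lnorm_ge0. Qed.

Lemma L2_sq_integrable f : f \in L2 -> mu.-integrable setT (EFin \o (fun x => f x ^+ 2)).
Proof. exact: Lfun2_integrable_sqr. Qed.

Lemma L2_mul_integrable f g : f \in L2 -> g \in L2 ->
  mu.-integrable setT (EFin \o (fun x => f x * g x)).
Proof. by move=> fL gL; apply/Lfun1_integrable; exact: Lfun2_mul_Lfun1. Qed.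

Lemma L2_ler f g : measurable_fun setT g -> f \in L2 ->
  (forall x, `|g x| <= `|f x|) -> g \in L2.
Proof.
move=> mg fL gf; apply/andP; split; rewrite inE//= /finite_norm.
have mf := L2_measurable fL.
move: fL => /andP[_]; rewrite inE/= /finite_norm; apply: le_lt_trans.
have mpow (u : T -> R) : measurable_fun setT u ->
    measurable_fun setT (fun x => (`|u x| `^ 2)%:E).
  move=> mu'; apply/measurable_EFinP.
  apply: (@measurableT_comp _ _ _ _ _ _ (@powR R ^~ 2)) => //.
  exact: measurableT_comp.
rewrite unlock /Lnorm gt0_ler_poweR ?in_itv/= ?leey ?integral_ge0//.
apply: ge0_le_integral => //; [exact: mpow|exact: mpow|].
by move=> x _; rewrite lee_fin; apply: ge0_ler_powR; rewrite ?nnegrE.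
Qed.

Lemma L2_of_bounded_integrable f m : measurable_fun setT f ->
  (forall x, 0 <= f x) -> (forall x, f x <= m) ->
  mu.-integrable setT (EFin \o f) -> f \in L2.
Proof.
move=> mf f0 fm fI; rewrite inE; apply/andP; split; rewrite inE//= /finite_norm.
rewrite unlock /Lnorm poweR_lty//.
have mfI : mu.-integrable setT (fun x => (m%:E * (f x)%:E)%E).
  exact: (integrableZl _ m fI).
apply: le_lt_trans (integrable_lty measurableT mfI).
apply: ge0_le_integral => //; last 2 first.
- exact: measurable_int _ mfI.
- move=> x _ /=; rewrite lee_fin powR_mulrn// ger0_norm// expr2.
  exact: ler_wpM2r.
- by move=> x _; exact: poweR_ge0.
- have : measurable_fun setT (fun x => `|f x| `^ 2).
    by apply: (measurableT_comp (measurable_powR _)); exact: measurableT_comp.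
  by move/measurable_EFinP.
Qed.

Lemma l2norm_sq f : f \in L2 -> l2norm f ^+ 2 = \int[mu]_x (f x ^+ 2).
Proof.
move=> fL; have := L2norm_fin fL; rewrite unlock /Lnorm => NE.
have I0 : (0 <= \int[mu]_x (`|(EFin \o f) x| `^ 2))%E.
  by apply: integral_ge0 => x _; exact: poweR_ge0.
have : ((\int[mu]_x `|(EFin \o f) x| `^ 2) `^ 2^-1 `^ 2)%E = ((l2norm f) ^+ 2)%:E.
  by rewrite NE poweR_EFin powR_mulrn// l2norm_ge0.
rewrite -poweRrM mulVf// poweRe1// => E.
apply: EFin_inj; rewrite -E /Rintegral fineK; last first.
  by apply: integrable_fin_num => //; exact: L2_sq_integrable.
by apply: eq_integral => x _ /=; rewrite powR_mulrn// -normrX ger0_norm ?sqr_ge0.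
Qed.

Lemma l2norm_cauchy_schwarz f g : f \in L2 -> g \in L2 ->
  `|\int[mu]_x (f x * g x)| <= l2norm f * l2norm g.
Proof.
move=> fL gL; have fg := L2_mul_integrable fL gL.
apply: (le_trans (le_normr_Rintegral _ fg)) => //.
rewrite -lee_fin EFinM -!L2norm_fin// /Rintegral fineK; last first.
  apply: integrable_fin_num => //; exact: (integrable_norm fg).
have := @hoelder _ _ _ mu f g 2 2 (L2_measurable fL) (L2_measurable gL).
rewrite !ltr0n => /(_ isT isT); rewrite Lnorm1; apply.
by rewrite [RHS]splitr !div1r.
Qed.

Lemma l2normD f g : f \in L2 -> g \in L2 ->
  l2norm (fun x => f x + g x) <= l2norm f + l2norm g.
Proof.
move=> fL gL; rewrite -lee_fin EFinD -!L2norm_fin//; last exact: L2D.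
by apply: minkowski_EFin; rewrite ?ler1n//; exact: L2_measurable.
Qed.

Lemma l2normZ a f : f \in L2 -> l2norm (fun x => a * f x) = `|a| * l2norm f.
Proof.
move=> fL; apply: EFin_inj; rewrite EFinM -!L2norm_fin//; last exact: L2Z.
by rewrite -(LnormZ (Lfun_Sub two_ge1 fL)).
Qed.

Lemma l2normN f : l2norm (fun x => - f x) = l2norm f.
Proof.
by congr fine; rewrite -[RHS]oppe_Lnorm.
Qed.

Lemma l2normB f g : f \in L2 -> g \in L2 ->
  l2norm (fun x => f x - g x) <= l2norm f + l2norm g.
Proof.
move=> fL gL; rewrite -[X in _ <= _ + X]l2normN.
by apply: l2normD => //; exact: L2N.
Qed.

Definition pospart f x : R := Num.max (f x) 0.

Lemma L2_pospart f : f \in L2 -> pospart f \in L2.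
Proof.
move=> fL; apply: (L2_ler _ fL).
  by apply: measurable_maxr => //; exact: L2_measurable.
by move=> x; rewrite /pospart; case: (leP (f x) 0) => x0; rewrite ?normr0.
Qed.

Lemma l2norm_pospart f : f \in L2 -> l2norm (pospart f) <= l2norm f.
Proof.
move=> fL; have pL := L2_pospart fL.
rewrite -(@ler_pXn2r _ 2) ?nnegrE ?l2norm_ge0// !l2norm_sq//.
apply: le_Rintegral => //; [exact: L2_sq_integrable..|move=> x _].
by rewrite /pospart; case: (leP (f x) 0) => [_|//]; rewrite expr0n/= sqr_ge0.
Qed.

(** The square of the positive part is differentiable, with Lipschitz
    derivative. *)
Lemma pospart_sq_increment f g : f \in L2 -> g \in L2 ->
  \int[mu]_x (pospart g x ^+ 2) <= \int[mu]_x (pospart f x ^+ 2) +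
    2 * \int[mu]_x (pospart f x * (g x - f x)) + l2norm (fun x => g x - f x) ^+ 2.
Proof.
move=> fL gL; have dL := L2B gL fL; have pf := L2_pospart fL.
have pg := L2_pospart gL.
have i1 := L2_sq_integrable pf; have i3 := L2_sq_integrable dL.
have i2 := L2_mul_integrable pf dL.
have i2' : mu.-integrable setT (EFin \o (fun x => 2 * (pospart f x * (g x - f x)))).
  exact: (integrableZl _ 2 i2).
have i12 : mu.-integrable setT
    (EFin \o (fun x => pospart f x ^+ 2 + 2 * (pospart f x * (g x - f x)))).
  exact: (integrableD _ i1 i2').
rewrite l2norm_sq// -RintegralZl// -RintegralD// -RintegralD//.
apply: le_Rintegral => //; first exact: L2_sq_integrable.
  exact: (integrableD _ i12 i3).
move=> x _; rewrite /pospart /=.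
move: (f x) (g x) => a b; have := sqr_ge0 (b - a); have := sqr_ge0 b.
have := sqr_ge0 a; rewrite !expr2 => a2 b2 ba2.
case: (leP b 0) => b0; case: (leP a 0) => a0; try lra.
have : 0 <= - a * b by rewrite mulr_ge0 ?oppr_ge0// ltW.
lra.
Qed.

End square_integrable.
Arguments l2norm {d T R} mu f.

(** * Curves of square-integrable functions *)

Section L2_curves.
Context d (T : measurableType d) (R : realType).
Variable mu : {measure set T -> \bar R}.
Implicit Types (f g : T -> R) (u v : R -> T -> R) (t h e : R).
Local Notation L2 := (Lfun mu 2%:E).

(** The regularity that the semigroup generated by a subdifferential gives to its
    orbits. *)
Definition L2_curve u : Prop :=
  [/\ forall t, 0 <= t -> u t \in L2,
      forall e, 0 < e -> exists2 r, 0 < r &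
        forall t, 0 < t < r -> l2norm mu (fun x => u t x - u 0 x) <= e &
      forall r, 0 < r -> exists K, forall t1 t2, r <= t1 -> r <= t2 ->
        l2norm mu (fun x => u t1 x - u t2 x) <= K * `|t1 - t2|].

Definition L2_right_derivative u t g : Prop :=
  forall e, 0 < e -> exists2 r, 0 < r & forall h, 0 < h < r ->
    l2norm mu (fun x => u (t + h) x - u t x - h * g x) <= e * h.

Lemma L2_curveB u v : L2_curve u -> L2_curve v ->
  L2_curve (fun t x => u t x - v t x).
Proof.
move=> [uL u0 uK] [vL v0 vK]; split.
- by move=> t t0; apply: L2B; [exact: uL|exact: vL].
- move=> e e0; have e2 : 0 < e / 2 by lra.
  have [r1 r10 h1] := u0 _ e2; have [r2 r20 h2] := v0 _ e2.
  exists (Num.min r1 r2); first by rewrite lt_min r10.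
  move=> t /andP[t0]; rewrite lt_min => /andP[t1 t2].
  rewrite (_ : (fun x => _) = fun x => (u t x - u 0 x) - (v t x - v 0 x)).
    apply: (le_trans (l2normB _ _)).
    + by apply: L2B; apply: uL; lra.
    + by apply: L2B; apply: vL; lra.
    + rewrite (splitr e) lerD ?h1 ?h2 ?t0//.
  by apply/funext => x; ring.
- move=> r r0; have [K1 h1] := uK _ r0; have [K2 h2] := vK _ r0.
  exists (K1 + K2) => t1 t2 rt1 rt2.
  rewrite (_ : (fun x => _) = fun x => (u t1 x - u t2 x) - (v t1 x - v t2 x)).
    apply: (le_trans (l2normB _ _)).
    + by apply: L2B; apply: uL; lra.
    + by apply: L2B; apply: vL; lra.
    + by rewrite mulrDl lerD ?h1 ?h2.
  by apply/funext => x; ring.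
Qed.

Lemma L2_right_derivativeB u v t f g : (forall t, 0 <= t -> u t \in L2) ->
  (forall t, 0 <= t -> v t \in L2) -> 0 <= t -> f \in L2 -> g \in L2 ->
  L2_right_derivative u t f -> L2_right_derivative v t g ->
  L2_right_derivative (fun t x => u t x - v t x) t (fun x => f x - g x).
Proof.
move=> uL vL t0 fL gL uf vg e e0; have e2 : 0 < e / 2 by lra.
have [r1 r10 h1] := uf _ e2; have [r2 r20 h2] := vg _ e2.
exists (Num.min r1 r2); first by rewrite lt_min r10.
move=> h /andP[h0]; rewrite lt_min => /andP[hr1 hr2].
rewrite (_ : (fun x => _) = fun x => (u (t + h) x - u t x - h * f x) -
    (v (t + h) x - v t x - h * g x)); last by apply/funext => x; ring.
apply: (le_trans (l2normB _ _)).
- by apply: L2B; [apply: L2B; apply: uL; lra|exact: L2Z].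
- by apply: L2B; [apply: L2B; apply: vL; lra|exact: L2Z].
- by rewrite (splitr e) mulrDl lerD ?h1 ?h2 ?h0.
Qed.

Lemma L2_curve_bounded u r t0 : L2_curve u -> 0 < r -> exists M,
  forall t, r <= t <= t0 -> l2norm mu (u t) <= M.
Proof.
move=> [uL _ uK] r0; have [K hK] := uK _ r0.
exists (l2norm mu (u r) + `|K| * (t0 - r)) => t /andP[rt tt0].
rewrite (_ : u t = fun x => u r x + (u t x - u r x)); last first.
  by apply/funext => x; ring.
apply: (le_trans (l2normD _ _)); [by apply: uL; lra|by apply: L2B; apply: uL; lra|].
rewrite lerD2l; apply: (le_trans (hK _ _ rt (lexx r))).
rewrite ger0_norm ?subr_ge0//; apply: (@le_trans _ _ (`|K| * (t - r))).
  by apply: ler_wpM2r (ler_norm K); lra.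
by apply: ler_wpM2l => //; lra.
Qed.

(** Since the derivative of the squared norm of the positive part is twice the
    pairing of the positive part with the derivative, that norm decreases. The
    Lipschitz bound, needed to integrate an inequality that holds almost
    everywhere, is available only away from time zero, which is reached by
    continuity. *)
Lemma L2_curve_pospart_le u t : L2_curve u -> 0 <= t ->
  {ae @lebesgue_measure R, forall t, 0 < t -> exists g,
    [/\ g \in L2, L2_right_derivative u t g &
        \int[mu]_x (pospart (u t) x * g x) <= 0]} ->
  \int[mu]_x (pospart (u t) x ^+ 2) <= \int[mu]_x (pospart (u 0) x ^+ 2).
Proof.
move=> uc t0 deriv; have [uL u0 uK] := uc.
pose P t := \int[mu]_x (pospart (u t) x ^+ 2).
have incr t1 t2 : 0 <= t1 -> 0 <= t2 -> P t2 <= P t1 +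
    2 * \int[mu]_x (pospart (u t1) x * (u t2 x - u t1 x)) +
    l2norm mu (fun x => u t2 x - u t1 x) ^+ 2.
  by move=> t10 t20; apply: pospart_sq_increment; exact: uL.
have CS t1 g : 0 <= t1 -> g \in L2 ->
    \int[mu]_x (pospart (u t1) x * g x) <= l2norm mu (u t1) * l2norm mu g.
  move=> t10 gL; have uL1 := uL _ t10; have pL := L2_pospart uL1.
  apply: (le_trans (ler_norm _)).
  apply: (le_trans (l2norm_cauchy_schwarz pL gL)).
  by apply: ler_wpM2r; [exact: l2norm_ge0|exact: l2norm_pospart].
have decr r : 0 < r -> r <= t -> P t <= P r.
  move=> r0 rt; have [M hM] := L2_curve_bounded t uc r0.
  have [K hK] := uK _ r0.
  have M0 : 0 <= M by apply: le_trans (hM r _); rewrite ?l2norm_ge0 ?lexx.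
  pose K1 := 2 * M * `|K| + `|K| ^+ 2 * (t - r).
  suff : P t - P r <= 0 * (t - r) by rewrite mul0r subr_le0.
  apply: (@lipschitz_ae_increment_le _ P r t K1) => //.
    have half t1 t2 : r <= t1 <= t -> r <= t2 <= t -> P t2 - P t1 <= K1 * `|t2 - t1|.
      move=> /andP[r1 t1t] /andP[r2 t2t].
      have t1p : 0 <= t1 by lra.
      have t2p : 0 <= t2 by lra.
      have dL := L2B (uL _ t2p) (uL _ t1p).
      have := incr _ _ t1p t2p.
      have := CS _ _ t1p dL.
      have := hM t1; rewrite r1 t1t => /(_ isT).
      set I := Rintegral _ _ _.
      set D := l2norm mu (fun x => u t2 x - u t1 x).
      have D0 : 0 <= D by exact: l2norm_ge0.
      have DK : D <= `|K| * `|t2 - t1|.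
        apply: (le_trans (hK _ _ r2 r1)).
        by apply: ler_wpM2r => //; exact: ler_norm.
      have : `|t2 - t1| <= t - r by rewrite ler_norml; lra.
      have := normr_ge0 (t2 - t1); have := normr_ge0 K.
      have := l2norm_ge0 mu (u t1).
      move: DK; rewrite /K1; move: `|K| `|t2 - t1| => k a.
      move: (l2norm mu (u t1)) => n DK n0 k0 a0 at_ nM In PP.
      have : n * D <= M * (k * a) by exact: ler_pM.
      have : D ^+ 2 <= k ^+ 2 * a * (t - r).
        apply: (@le_trans _ _ ((k * a) ^+ 2)).
          by rewrite ler_pXn2r ?nnegrE ?mulr_ge0.
        rewrite exprMn (expr2 a) mulrA.
        by apply: ler_wpM2l => //; rewrite mulr_ge0 ?sqr_ge0.
      lra.
    move=> x y rx xy yt.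
    have -> : y - x = `|y - x| by rewrite ger0_norm// subr_ge0.
    rewrite ler_norml lerNl opprB; apply/andP; split; last by apply: half; lra.
    by rewrite distrC; apply: half; lra.
  apply: (@filterS _ _ (ae_filter_ringOfSetsType _) _ _ _ deriv) => t1 dt1 /andP[rt1 t1t] e e0.
  have t10 : 0 < t1 by lra.
  have [g [gL dg pg]] := dt1 t10.
  pose G := l2norm mu g + 1; have G0 : 0 <= l2norm mu g by exact: l2norm_ge0.
  (* The errors [2 * M * (e1 * h)] and [(G * h) ^+ 2] are at most [e / 2 * h]. *)
  pose e1 := Num.min 1 (e / (4 * (M + 1))).
  have e10 : 0 < e1 by rewrite lt_min ltr01 divr_gt0//; lra.
  have e11 : e1 <= 1 by rewrite ge_min lexx.
  have e12 : e1 * (4 * (M + 1)) <= e.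
    rewrite -ler_pdivlMr; last lra.
    by rewrite ge_min lexx orbT.
  have [r1 r10 hr1] := dg _ e10.
  pose G2 := 2 * (G ^+ 2 + 1).
  have G20 : 0 < G2 by rewrite /G2; have := sqr_ge0 G; lra.
  exists (Num.min r1 (e / G2)); first by rewrite lt_min r10 divr_gt0.
  move=> h /andP[h0]; rewrite lt_min => /andP[hr he].
  have th0 : 0 <= t1 + h by lra.
  have dL := L2B (uL _ th0) (uL _ (ltW t10)).
  have hgL := L2Z h gL.
  have rL := L2B dL hgL.
  have inc := incr _ _ (ltW t10) th0.
  have nr : l2norm mu (fun x => u (t1 + h) x - u t1 x - h * g x) <= e1 * h.
    by apply: hr1; rewrite h0.
  have pL := L2_pospart (uL _ (ltW t10)).
  have splitI : \int[mu]_x (pospart (u t1) x * (u (t1 + h) x - u t1 x)) =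
      h * \int[mu]_x (pospart (u t1) x * g x) +
      \int[mu]_x (pospart (u t1) x * (u (t1 + h) x - u t1 x - h * g x)).
    rewrite -RintegralZl//; last exact: L2_mul_integrable.
    rewrite -RintegralD//; last exact: L2_mul_integrable.
      by apply: eq_Rintegral => x _; ring.
    exact: (integrableZl _ h (L2_mul_integrable pL gL)).
  have remI := CS _ _ (ltW t10) rL.
  have rem2 : l2norm mu (u t1) * l2norm mu (fun x => u (t1 + h) x - u t1 x - h * g x)
      <= M * (e1 * h).
    by apply: ler_pM; rewrite ?l2norm_ge0// hM// rt1 ltW.
  have nd : l2norm mu (fun x => u (t1 + h) x - u t1 x) <= G * h.
    rewrite (_ : (fun x => _) = fun x =>
      (u (t1 + h) x - u t1 x - h * g x) + h * g x); last by apply/funext => x; ring.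
    apply: (le_trans (l2normD rL hgL)).
    rewrite l2normZ// (gtr0_norm h0) /G mulrDl mul1r [leRHS]addrC mulrC lerD2r.
    by apply: (le_trans nr); rewrite ler_piMl// ltW.
  have nd2 : l2norm mu (fun x => u (t1 + h) x - u t1 x) ^+ 2 <= G ^+ 2 * h * h.
    rewrite -mulrA -expr2 -exprMn ler_pXn2r// nnegrE ?l2norm_ge0//.
    by rewrite (le_trans _ nd) ?l2norm_ge0.
  have hI : h * \int[mu]_x (pospart (u t1) x * g x) <= 0.
    by rewrite pmulr_rle0.
  have hG : G ^+ 2 * h * h <= e / 2 * h.
    apply: ler_wpM2r; first exact: ltW.
    have : h * G2 <= e by rewrite -ler_pdivlMr// ltW.
    rewrite /G2; lra.
  have hM2 : 2 * (M * (e1 * h)) <= e / 2 * h.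
    have : e1 * (4 * (M + 1)) * h <= e * h by apply: ler_wpM2r => //; exact: ltW.
    have : 0 <= e1 * h by rewrite mulr_ge0 ?ltW.
    lra.
  rewrite -/(P _) in inc *; rewrite splitI in inc; rewrite add0r.
  lra.
move: t0; rewrite le_eqVlt => /predU1P[<-//|t0].
apply/ler_addgt0Pr => e e0.
pose M := l2norm mu (u 0); have M0 : 0 <= M by exact: l2norm_ge0.
pose e1 := Num.min 1 (e / (2 * M + 1)).
have e10 : 0 < e1 by rewrite lt_min ltr01 divr_gt0//; lra.
have e11 : e1 <= 1 by rewrite ge_min lexx.
have e12 : e1 * (2 * M + 1) <= e.
  rewrite -ler_pdivlMr; last lra.
  by rewrite ge_min lexx orbT.
have [r r0 hr] := u0 _ e10.
pose q := Num.min (r / 2) t.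
have q0 : 0 < q by rewrite lt_min t0 divr_gt0.
have qt : q <= t by rewrite ge_min lexx orbT.
have qr : q < r by rewrite gt_min; apply/orP; left; lra.
apply: (le_trans (decr _ q0 qt)).
apply: (le_trans (incr _ _ (lexx 0) (ltW q0))).
have dL := L2B (uL _ (ltW q0)) (uL _ (lexx 0)).
have := CS _ _ (lexx 0) dL; rewrite -/M -/(P 0).
have : l2norm mu (fun x => u q x - u 0 x) <= e1 by apply: hr; rewrite q0.
have : 0 <= l2norm mu (fun x => u q x - u 0 x) by exact: l2norm_ge0.
move: (l2norm _ _) (Rintegral _ _ _) => D I D0 De IMD.
have : D ^+ 2 <= e1 * 1 by rewrite expr2 ler_pM// (le_trans De).
have : M * D <= M * e1 by exact: ler_wpM2l.
lra.
Qed.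

(** A bound [X' >= - c (X + m)] on a time interval of length at most [1 / (2 c)]
    integrates to [X <= 2 X (t1) + m]: the supremum [S] of [X] satisfies
    [S <= X (t1) + (S + m) / 2]. *)
Lemma L2_curve_backward_bound u f t1 c m : L2_curve u -> f \in L2 -> 0 <= c ->
  0 <= m -> 0 < t1 -> c * t1 <= 2^-1 ->
  (forall t, 0 <= t -> 0 <= \int[mu]_x (f x * u t x)) ->
  {ae @lebesgue_measure R, forall t, 0 < t -> exists g,
    [/\ g \in L2, L2_right_derivative u t g &
        - (c * (\int[mu]_x (f x * u t x) + m)) <= \int[mu]_x (f x * g x)]} ->
  forall t, 0 <= t <= t1 ->
    \int[mu]_x (f x * u t x) <= 2 * \int[mu]_x (f x * u t1 x) + m.
Proof.
move=> uc fL c0 m0 t10 ct1; have [uL u0 uK] := uc.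
pose X t := \int[mu]_x (f x * u t x).
rewrite -/(X t1) => X0 deriv.
have XB s t : 0 <= s -> 0 <= t ->
    X s - X t = \int[mu]_x (f x * (u s x - u t x)).
  move=> s0 t0; rewrite /X -RintegralB//; try exact: L2_mul_integrable (uL _ _).
  by apply: eq_Rintegral => x _; rewrite mulrBr.
pose F := l2norm mu f; have F0 : 0 <= F by exact: l2norm_ge0.
have pos t : 0 < t <= t1 -> X t <= 2 * X t1 + m.
  move=> /andP[t0 tt1].
  have [K hK] := uK _ t0.
  have Xlip : lipschitz_on t t1 (F * `|K|) (fun t => - X t).
    move=> x y tx xy yt1; rewrite -opprD normrN XB; try lra.
    have dL : (fun z => u y z - u x z) \in L2 by apply: L2B; apply: uL; lra.
    apply: (le_trans (l2norm_cauchy_schwarz fL dL)).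
    rewrite -mulrA; apply: ler_wpM2l => //.
    apply: (le_trans (hK _ _ _ _)); [lra|exact: tx|].
    rewrite ger0_norm ?subr_ge0//; apply: ler_wpM2r (ler_norm K); lra.
  pose S := [set X s | s in [set s | t <= s <= t1]].
  have supS : has_sup S.
    split; first by exists (X t); exists t => //=; rewrite lexx.
    exists (X t + F * `|K| * (t1 - t)) => _ [s /= /andP[ts st1] <-].
    have := Xlip t s (lexx t) ts st1; rewrite ler_norml => /andP[+ _].
    have : F * `|K| * (s - t) <= F * `|K| * (t1 - t).
      by apply: ler_wpM2l; rewrite ?mulr_ge0//; lra.
    lra.
  pose M := sup S.
  have XM s : t <= s <= t1 -> X s <= M.
    by move=> st; apply: (sup_upper_bound supS); exists s.
  have M0 : 0 <= M by apply: le_trans (XM t _); rewrite ?X0 ?lexx// ltW.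
  have step s : t <= s <= t1 -> X s <= X t1 + (M + m) / 2.
    move=> /andP[ts st1].
    have : - X t1 - - X s <= c * (M + m) * (t1 - s).
      apply: (@lipschitz_ae_increment_le _ (fun t => - X t) s t1 (F * `|K|)) => //.
        by move=> x y sx xy yt1; apply: Xlip => //; exact: le_trans sx.
      apply: (@filterS _ _ (ae_filter_ringOfSetsType _) _ _ _ deriv) => x dx /andP[sx xt1] e e0.
      have x0 : 0 < x by lra.
      have [g [gL dg cg]] := dx x0.
      have e10 : 0 < e / (F + 1) by rewrite divr_gt0//; lra.
      have [r r0 hr] := dg _ e10; exists r => // h /[dup] /andP[h0 _] hhr.
      have nr := hr _ hhr.
      have xh0 : 0 <= x + h by lra.
      have dL := L2B (uL _ xh0) (uL _ (ltW x0)).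
      have rL := L2B dL (L2Z h gL).
      have splitI : X (x + h) - X x = h * \int[mu]_x (f x * g x) +
          \int[mu]_z (f z * (u (x + h) z - u x z - h * g z)).
        rewrite (XB _ _ xh0 (ltW x0)) -RintegralZl//; last exact: L2_mul_integrable.
        rewrite -RintegralD//; last exact: L2_mul_integrable.
          by apply: eq_Rintegral => z _; ring.
        exact: (integrableZl _ h (L2_mul_integrable fL gL)).
      have := l2norm_cauchy_schwarz fL rL; rewrite ler_norml => /andP[+ _].
      have : F * l2norm mu (fun z => u (x + h) z - u x z - h * g z) <= e * h.
        apply: (@le_trans _ _ (F * (e / (F + 1) * h))); first exact: ler_wpM2l.
        rewrite mulrA; apply: ler_wpM2r; first exact: ltW.
        rewrite mulrCA -[leRHS]mulr1 ler_pM2l// ler_pdivrMr; lra.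
      have hcg : h * (- (c * (X x + m))) <= h * \int[mu]_x (f x * g x).
        by apply: ler_wpM2l => //; exact: ltW.
      have : h * (c * (X x + m)) <= h * (c * (M + m)).
        apply: ler_wpM2l; first exact: ltW.
        by apply: ler_wpM2l => //; rewrite lerD2r XM//; lra.
      rewrite -/F; lra.
    have : c * (M + m) * (t1 - s) <= (M + m) / 2.
      rewrite -mulrA mulrCA; apply: ler_wpM2l; first lra.
      by apply: le_trans ct1; apply: ler_wpM2l => //; lra.
    lra.
  have MX : M <= X t1 + (M + m) / 2.
    apply: ge_sup; first by case: supS.
    by move=> _ [s st <-]; exact: step.
  by apply: (@le_trans _ _ M); [apply: XM; rewrite lexx|lra].
move=> t /andP[]; rewrite le_eqVlt => /predU1P[<- _|t0 tt1]; last first.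
  by apply: pos; rewrite t0.
rewrite -/(X 0); apply/ler_addgt0Pr => e e0.
have e10 : 0 < e / (F + 1) by rewrite divr_gt0//; lra.
have [r r0 hr] := u0 _ e10.
pose q := Num.min (r / 2) t1.
have q0 : 0 < q by rewrite lt_min t10 divr_gt0.
have qt : q <= t1 by rewrite ge_min lexx orbT.
have qr : q < r by rewrite gt_min; apply/orP; left; lra.
have qpos : X q <= 2 * X t1 + m by apply: pos; rewrite q0.
have dL := L2B (uL _ (ltW q0)) (uL _ (lexx 0)).
have := l2norm_cauchy_schwarz fL dL.
rewrite -(XB _ _ (ltW q0) (lexx 0)) ler_norml => /andP[+ _].
have : F * l2norm mu (fun x => u q x - u 0 x) <= e.
  apply: (@le_trans _ _ (F * (e / (F + 1)))).
    by apply: ler_wpM2l => //; apply: hr; rewrite q0.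
  rewrite mulrCA -[leRHS]mulr1 ler_pM2l// ler_pdivrMr; lra.
rewrite -/F; lra.
Qed.

End L2_curves.

(** * The fractional kernel and a test function adapted to it *)

Section l1_geometry.
Context {R : realType} {N : nat}.
Local Notation E := (N.-tuple R).
Local Notation mu := (@leb R N).
Implicit Types (x y z : E) (r t b : R) (f : E -> R).

(** A distance with an immediate triangle inequality, equivalent to the Euclidean
    one. *)
Definition l1_dist x y : R := \sum_(i < N) `|tnth x i - tnth y i|.

Lemma l1_dist_ge0 x y : 0 <= l1_dist x y.
Proof. exact: sumr_ge0. Qed.

Lemma l1_dist_sym x y : l1_dist x y = l1_dist y x.
Proof. by apply: eq_bigr => i _; rewrite distrC. Qed.

Lemma l1_dist_triangle z x y : l1_dist x y <= l1_dist x z + l1_dist z y.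
Proof. by rewrite /l1_dist -big_split; apply: ler_sum => i _; exact: ler_distD. Qed.

Lemma eucl_dist_sym x y : eucl_dist x y = eucl_dist y x.
Proof.
by congr Num.sqrt; apply: eq_bigr => i _; rewrite -sqrrN opprB.
Qed.

Lemma l1_dist_le_eucl x y : l1_dist x y <= N%:R * eucl_dist x y.
Proof.
have sq_le i : `|tnth x i - tnth y i| <= eucl_dist x y.
  rewrite -sqrtr_sqr ler_wsqrtr// (bigD1 i)//= lerDl.
  by apply: sumr_ge0 => j _; exact: sqr_ge0.
apply: (le_trans (ler_sum _ (fun i _ => sq_le i))).
by rewrite sumr_const card_ord mulr_natl.
Qed.

Lemma measurable_eucl_dist :
  measurable_fun setT (fun z : E * E => eucl_dist z.1 z.2).
Proof.
rewrite (_ : (fun _ => _) = fun z : E * E =>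
  (\sum_(i < N) (tnth z.1 i - tnth z.2 i) ^+ 2) `^ 2^-1); last first.
  apply/funext => z; rewrite powR12_sqrt//.
  by apply: sumr_ge0 => i _; exact: sqr_ge0.
apply: (measurableT_comp (measurable_powR _)) => //.
apply: measurable_sum => i; apply: measurable_funX.
by apply: measurable_funB;
  apply: (measurableT_comp (@measurable_tnth _ R N i)).
Qed.

Lemma measurable_l1_dist1 x : measurable_fun setT (l1_dist x).
Proof.
apply: measurable_sum => i; apply: measurableT_comp => //.
by apply: measurable_funB => //; exact: measurable_tnth.
Qed.

Definition l1_ball x r : set E := [set y | l1_dist x y < r].

Lemma measurable_l1_ball x r : measurable (l1_ball x r).
Proof.
rewrite (_ : l1_ball x r = setT `&` l1_dist x @^-1` `]-oo, r[).
  by apply: measurable_l1_dist1.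
by apply/seteqP; split => y /=; rewrite in_itv/= => -[].
Qed.

(** The ball sits in a cube of side [2 r]. *)
Lemma leb_l1_ball_le x r : 0 < r -> (mu (l1_ball x r) <= ((2 * r) ^+ N)%:E)%E.
Proof.
move=> r0.
pose A (i : 'I_N) : set R := `]tnth x i - r, tnth x i + r[%classic.
have mA i : measurable (A i) by exact: measurable_itv.
have vol : mu [set y | forall i, A i (tnth y i)] = ((2 * r) ^+ N)%:E.
  rewrite leb_box// (eq_bigr (fun=> (2 * r)%:E)).
    by rewrite prodEFin prodr_const card_ord.
  move=> i _; rewrite lebesgue_measure_itv/= lte_fin ifT; last lra.
  by rewrite -EFinB; congr EFin; ring.
rewrite -vol; apply: le_measure; rewrite ?inE.
- exact: measurable_l1_ball.
- rewrite (_ : [set _ | _] = \bigcap_(i in [set: 'I_N])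
      ((fun y : E => tnth y i) @^-1` A i)).
    apply: fin_bigcap_measurable => // i _.
    by rewrite -[X in measurable X]setTI; exact: measurable_tnth.
  by apply/seteqP; split=> y /= yA i => [_|]; exact: yA.
- move=> y; rewrite /l1_ball/= => xy i; rewrite /A/= in_itv/=.
  have : `|tnth x i - tnth y i| < r.
    by apply: le_lt_trans xy; rewrite /l1_dist (bigD1 i)//= lerDl sumr_ge0.
  by rewrite ltr_norml; lra.
Qed.

Lemma geometric_sum_le t n : 0 <= t < 1 -> \sum_(0 <= k < n) t ^+ k <= (1 - t)^-1.
Proof.
move=> /andP[t0 t1]; have t1' : 0 < 1 - t by lra.
suff -> : \sum_(0 <= k < n) t ^+ k = (1 - t ^+ n) / (1 - t).
  by rewrite -[leRHS]mul1r ler_pM2r ?invr_gt0// gerBl exprn_ge0.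
elim: n => [|n IH]; first by rewrite big_nil expr0 subrr mul0r.
by rewrite big_nat_recr//= IH exprS; field; lra.
Qed.

(** A function that is dominated by [q `^ (t - N)] on the ball of radius [2 q],
    for [q] along a geometric sequence of scales, has an integral controlled by
    the first scale as soon as [q `^ t] decays along the sequence. *)
Lemma shell_integral_le x f r b t : 0 < r -> 0 < b -> b `^ t < 1 ->
  measurable_fun setT f -> (forall y, 0 <= f y) ->
  (forall y, f y != 0 -> exists k : nat,
    f y <= (r * b ^+ k) `^ (t - N%:R) /\ l1_dist x y < 2 * (r * b ^+ k)) ->
  (\int[mu]_y (f y)%:E <= (4 ^+ N * r `^ t / (1 - b `^ t))%:E)%E.
Proof.
move=> r0 b0 bt mf f0 shell.
pose q k := r * b ^+ k.
have q0 k : 0 < q k by rewrite mulr_gt0 ?exprn_gt0.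
have q20 k : 0 < 2 * q k by rewrite mulr_gt0.
pose g k y := ((q k `^ (t - N%:R))%:E * (\1_(l1_ball x (2 * q k)) y)%:E)%E.
have g0 k y : (0 <= g k y)%E by rewrite mule_ge0// lee_fin ?powR_ge0.
have mi k : measurable_fun setT (fun y => (\1_(l1_ball x (2 * q k)) y : R)%:E).
  by apply/measurable_EFinP; apply: measurable_indic; exact: measurable_l1_ball.
have mg k : measurable_fun setT (g k) by apply: measurable_funeM; exact: mi.
have fg y : ((f y)%:E <= \sum_(k <oo) g k y)%E.
  have [->|/shell[k [fk xk]]] := eqVneq (f y) 0; first exact: nneseries_ge0.
  apply: (@le_trans _ _ (\sum_(0 <= i < k.+1) g i y)%E); last first.
    exact: nneseries_lim_ge.
  rewrite big_nat_recr//= (@le_trans _ _ (g k y))//; last first.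
    by rewrite leeDr// sume_ge0.
  by rewrite /g indicE mem_set//= mule1 lee_fin.
apply: (@le_trans _ _ (\int[mu]_y (\sum_(k <oo) g k y))%E).
  apply: ge0_le_integral => //.
  - by move=> y _; rewrite lee_fin.
  - exact/measurable_EFinP.
  - exact: ge0_emeasurable_sum.
rewrite integral_nneseries//.
apply: lime_le; first by apply: is_cvg_nneseries => k _ _; exact: integral_ge0.
apply: nearW => n.
apply: (@le_trans _ _ (\sum_(0 <= k < n) (4 ^+ N * r `^ t * (b `^ t) ^+ k)%:E)%E).
  apply: lee_sum => k _.
  rewrite /g ge0_integralZl//; last by rewrite lee_fin powR_ge0.
  rewrite integral_indic ?setIT//; last exact: measurable_l1_ball.
  apply: (@le_trans _ _ ((q k `^ (t - N%:R))%:E * ((2 * (2 * q k)) ^+ N)%:E)%E).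
    by apply: lee_wpmul2l; [rewrite lee_fin powR_ge0|exact: leb_l1_ball_le].
  rewrite -EFinM lee_fin le_eqVlt; apply/orP; left; apply/eqP.
  rewrite mulrA (_ : 2 * 2 = 4 :> R); last by ring.
  rewrite exprMn mulrCA -(powR_mulrn N (ltW (q0 k))) -powRD; last first.
    by rewrite (gt_eqF (q0 k)) implybT.
  rewrite subrK /q powRM ?(ltW r0) ?exprn_ge0 ?(ltW b0)// -!mulrA; congr (_ * (_ * _)).
  rewrite -(powR_mulrn k (ltW b0)) -(powR_mulrn k (powR_ge0 b t)) -!powRrM.
  by rewrite [k%:R * t]mulrC.
rewrite sumEFin lee_fin -big_distrr/=; apply: ler_wpM2l.
  by rewrite mulr_ge0 ?exprn_ge0 ?powR_ge0.
by apply: geometric_sum_le; rewrite powR_ge0.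
Qed.

End l1_geometry.

Section test_function.
Context {R : realType} {N : nat}.
Local Notation E := (N.-tuple R).
Local Notation mu := (@leb R N).
Implicit Types (x y z : E) (r q a : R).

Lemma exists_pow2_gt r : exists k : nat, r < 2 ^+ k.
Proof.
exists (Num.bound `|r|); apply: (le_lt_trans (ler_norm r)).
apply: (lt_trans (archi_boundP (normr_ge0 r))).
by rewrite -natrX ltr_nat ltn_expl.
Qed.

Lemma dyadic_above r q : 0 < r -> r <= q ->
  exists k : nat, r * 2 ^+ k <= q < 2 * (r * 2 ^+ k).
Proof.
move=> r0 rq; have ex : exists k : nat, q < 2 * (r * 2 ^+ k).
  have [k hk] := exists_pow2_gt (q / r); exists k.
  have : 0 < r * 2 ^+ k by rewrite mulr_gt0// exprn_gt0.
  move: hk; rewrite ltr_pdivrMr//; lra.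
case: (ex_minnP ex) => k hk mk; exists k; rewrite hk andbT.
case: k hk mk => [|k] _ mk; first by rewrite expr0 mulr1.
rewrite leNgt; apply/negP => qk.
have : (k.+1 <= k)%N by apply: mk; move: qk; rewrite exprS; lra.
by rewrite ltnn.
Qed.

Lemma dyadic_below r q : 0 < q -> q < 2 * r ->
  exists k : nat, r * 2^-1 ^+ k <= q < 2 * (r * 2^-1 ^+ k).
Proof.
move=> q0 qr; have ex : exists k : nat, r * 2^-1 ^+ k <= q.
  have [k hk] := exists_pow2_gt (r / q); exists k.
  have k0 : 0 < 2 ^+ k :> R by rewrite exprn_gt0.
  by move: hk; rewrite exprVn ler_pdivrMr// ltr_pdivrMr// mulrC => /ltW.
case: (ex_minnP ex) => k hk mk; exists k; rewrite hk/=.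
case: k hk mk => [|k] _ mk; first by rewrite expr0 mulr1.
rewrite ltNge; apply/negP => kq.
have : (k.+1 <= k)%N by apply: mk; move: kq; rewrite exprS; lra.
by rewrite ltnn.
Qed.

Lemma powR_opp_le a q r : 0 <= a -> 0 < q -> q <= r -> r `^ (- a) <= q `^ (- a).
Proof.
move=> a0 q0 qr; have r0 := lt_le_trans q0 qr.
rewrite !powRN lef_pV2 ?posrE ?powR_gt0//.
by apply: ge0_ler_powR; rewrite ?nnegrE// ltW.
Qed.

Section order.
Context {sigma : R} (sigma01 : 0 < sigma < 1) (N0 : (0 < N)%N).
Local Notation a := (N%:R + sigma).

Let N1 : 1 <= N%:R :> R. Proof. by rewrite ler1n. Qed.
Let sigma0 : 0 < sigma. Proof. by case/andP: sigma01. Qed.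
Let sigma1 : sigma < 1. Proof. by case/andP: sigma01. Qed.

Let a1 : 0 < a - 1. Proof. by have := sigma0; have := N1; lra. Qed.
Let a_gt0 : 0 < a. Proof. by have := a1; lra. Qed.
Let a_ge0 : 0 <= a. Proof. exact: ltW. Qed.

Definition near_kernel x q y := if l1_dist x y < q then l1_dist x y `^ (1 - a) else 0.

Definition far_kernel x q y := if l1_dist x y < q then 0 else l1_dist x y `^ (- a).

Definition far_const : R := 4 ^+ N / (1 - 2 `^ (- sigma)).

Definition near_const : R := 4 ^+ N * 2^-1 `^ (1 - sigma) / (1 - 2^-1 `^ (1 - sigma)).

Let pow_far : 2 `^ (- sigma) < 1 :> R.
Proof.
rewrite powRN invf_lt1 ?powR_gt0//.
by have := gt0_ltr_powR sigma0; move=> /(_ 1 2); rewrite powR1 !nnegrE; apply => //; lra.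
Qed.

Let pow_near : 2^-1 `^ (1 - sigma) < 1 :> R.
Proof.
have s0 : 0 < 1 - sigma by rewrite subr_gt0.
by have := gt0_ltr_powR s0; move=> /(_ 2^-1 1); rewrite powR1 !nnegrE; apply => //; lra.
Qed.

Lemma far_const_gt0 : 0 < far_const.
Proof. by rewrite divr_gt0 ?exprn_gt0// subr_gt0. Qed.

Lemma near_const_gt0 : 0 < near_const.
Proof. by rewrite divr_gt0 ?mulr_gt0 ?exprn_gt0 ?powR_gt0// ?subr_gt0// invr_gt0. Qed.

Lemma near_kernel_ge0 x q y : 0 <= near_kernel x q y.
Proof. by rewrite /near_kernel; case: ifP => // _; rewrite powR_ge0. Qed.

Lemma far_kernel_ge0 x q y : 0 <= far_kernel x q y.
Proof. by rewrite /far_kernel; case: ifP => // _; rewrite powR_ge0. Qed.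

Lemma measurable_near_kernel x q : measurable_fun setT (near_kernel x q).
Proof.
apply: measurable_fun_ifT => //.
  by apply: measurable_fun_ltr => //; exact: measurable_l1_dist1.
by apply: (measurableT_comp (measurable_powR _)); exact: measurable_l1_dist1.
Qed.

Lemma measurable_far_kernel x q : measurable_fun setT (far_kernel x q).
Proof.
apply: measurable_fun_ifT => //.
  by apply: measurable_fun_ltr => //; exact: measurable_l1_dist1.
by apply: (measurableT_comp (measurable_powR _)); exact: measurable_l1_dist1.
Qed.

Lemma far_kernel_integral_le x q : 0 < q ->
  (\int[mu]_y (far_kernel x q y)%:E <= (far_const * q `^ (- sigma))%:E)%E.
Proof.
move=> q0; rewrite (_ : far_const * _ =
  4 ^+ N * q `^ (- sigma) / (1 - 2 `^ (- sigma))); last by rewrite mulrAC.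
apply: (@shell_integral_le _ _ x) => //.
- exact: measurable_far_kernel.
- exact: far_kernel_ge0.
- move=> y; rewrite /far_kernel; case: ltP => [|qd _]; first by rewrite eqxx.
  have [k /andP[k1 k2]] := dyadic_above q0 qd; exists k; split => //.
  rewrite (_ : - sigma - N%:R = - a); last by ring.
  by apply: powR_opp_le => //; rewrite mulr_gt0 ?exprn_gt0.
Qed.

(** The increment of a Lipschitz function weakens the singularity by one power,
    which makes it integrable because [sigma < 1]. *)
Lemma near_kernel_integral_le x q : 0 < q ->
  (\int[mu]_y (near_kernel x q y)%:E <= (near_const * q `^ (1 - sigma))%:E)%E.
Proof.
move=> q0; rewrite (_ : near_const * _ =
  4 ^+ N * (q / 2) `^ (1 - sigma) / (1 - 2^-1 `^ (1 - sigma))); last first.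
  by rewrite powRM ?invr_ge0 ?(ltW q0)// /near_const; ring.
apply: (@shell_integral_le _ _ x) => //.
- by rewrite divr_gt0.
- exact: measurable_near_kernel.
- exact: near_kernel_ge0.
- move=> y; rewrite /near_kernel; case: ltP => [dq|_]; last by rewrite eqxx.
  rewrite powR_eq0 negb_and negbK => d0.
  have {}d0 : 0 < l1_dist x y.
    rewrite lt_neqAle l1_dist_ge0 andbT eq_sym; case/orP: d0 => // /eqP; have := a1; lra.
  have [|k /andP[k1 k2]] := @dyadic_below (q / 2) (l1_dist x y) d0; first lra.
  exists k; split => //.
  rewrite (_ : 1 - sigma - N%:R = - (a - 1)); last by ring.
  rewrite (_ : 1 - a = - (a - 1)); last by ring.
  by apply: powR_opp_le; rewrite ?(ltW a1)// mulr_gt0 ?exprn_gt0 ?divr_gt0 ?invr_gt0.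
Qed.

Definition frac_kernel x y := (eucl_dist x y `^ a)^-1.

Lemma frac_kernel_ge0 x y : 0 <= frac_kernel x y.
Proof. by rewrite invr_ge0 powR_ge0. Qed.

Lemma frac_kernel_sym x y : frac_kernel x y = frac_kernel y x.
Proof. by rewrite /frac_kernel eucl_dist_sym. Qed.

Lemma measurable_frac_kernel :
  measurable_fun setT (fun z : E * E => frac_kernel z.1 z.2).
Proof.
rewrite (_ : (fun _ => _) = fun z : E * E => eucl_dist z.1 z.2 `^ (- a)).
  exact: (measurableT_comp (measurable_powR _) measurable_eucl_dist).
by apply/funext => z; rewrite powRN.
Qed.

Lemma frac_kernel_le_l1 x y : frac_kernel x y <= N%:R `^ a * l1_dist x y `^ (- a).
Proof.
have Np : 0 < N%:R :> R by rewrite ltr0n.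
(* On the diagonal both sides vanish, as the power of zero is zero. *)
have [d0|d0] := leP (l1_dist x y) 0.
  have dE : l1_dist x y = 0 by apply/eqP; rewrite eq_le d0 l1_dist_ge0.
  have -> : frac_kernel x y = 0; last by rewrite mulr_ge0 ?powR_ge0.
  rewrite /frac_kernel (_ : eucl_dist x y = 0) ?powR0 ?invr0 ?gt_eqF//.
  rewrite /eucl_dist big1 ?sqrtr0// => i _.
  have /psumr_eq0P all0 := dE.
  have /eqP := all0 (fun j _ => normr_ge0 _) i isT.
  by rewrite normr_eq0 => /eqP ->; rewrite expr0n.
have le := l1_dist_le_eucl x y.
have e0 : 0 < eucl_dist x y by rewrite -(pmulr_rgt0 _ Np) (lt_le_trans d0).
rewrite /frac_kernel -powRN.
have -> : N%:R `^ a * l1_dist x y `^ (- a) = (l1_dist x y / N%:R) `^ (- a).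
  rewrite powRM ?(ltW d0) ?invr_ge0 ?(ltW Np)// mulrC; congr (_ * _).
  by rewrite -powR_inv1 ?(ltW Np)// -powRrM mulN1r opprK.
apply: powR_opp_le; [exact: ltW|exact: divr_gt0|].
by rewrite ler_pdivrMr// mulrC.
Qed.

(** The decay exponent [N + sigma] is that of the kernel itself; it is what makes
    the nonlocal operator map this function to a multiple of itself. *)
Definition test_fun x0 r y := (r + l1_dist x0 y) `^ (- a).

Lemma test_fun_ge0 x0 r y : 0 <= test_fun x0 r y.
Proof. exact: powR_ge0. Qed.

Lemma test_fun_le x0 r y : 0 < r -> test_fun x0 r y <= r `^ (- a).
Proof. by move=> r0; apply: powR_opp_le => //; rewrite lerDl l1_dist_ge0. Qed.

Lemma measurable_test_fun x0 r : measurable_fun setT (test_fun x0 r).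
Proof.
apply: (measurableT_comp (measurable_powR _)).
by apply: measurable_funD => //; exact: measurable_l1_dist1.
Qed.

Lemma test_fun_integral_le x0 r : 0 < r ->
  (\int[mu]_y (test_fun x0 r y)%:E <= (far_const * r `^ (- sigma))%:E)%E.
Proof.
move=> r0; rewrite (_ : far_const * _ =
  4 ^+ N * r `^ (- sigma) / (1 - 2 `^ (- sigma))); last by rewrite mulrAC.
apply: (@shell_integral_le _ _ x0) => //.
- exact: measurable_test_fun.
- exact: test_fun_ge0.
- move=> y _; rewrite (_ : - sigma - N%:R = - a); last by ring.
  have d0 := l1_dist_ge0 x0 y.
  have [dr|rd] := ltP (l1_dist x0 y) r.
    exists 0%N; rewrite expr0 mulr1; split; last lra.
    exact: test_fun_le.
  have [k /andP[k1 k2]] := dyadic_above r0 rd; exists k; split => //.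
  by apply: powR_opp_le => //; [rewrite mulr_gt0 ?exprn_gt0|lra].
Qed.

Lemma test_fun_integrable x0 r : 0 < r ->
  mu.-integrable setT (EFin \o test_fun x0 r).
Proof.
move=> r0; apply/integrableP; split.
  by apply/measurable_EFinP; exact: measurable_test_fun.
apply: le_lt_trans (le_lt_trans (test_fun_integral_le x0 r0) (ltry _)).
by under eq_integral do rewrite /= ger0_norm ?test_fun_ge0//.
Qed.

Lemma test_fun_increment_le x0 r x y (q := (r + l1_dist x0 x) / 2) : 0 < r ->
  `|test_fun x0 r x - test_fun x0 r y| * l1_dist x y `^ (- a) <=
  N.+1%:R * q `^ (- a - 1) * near_kernel x q y +
  test_fun x0 r x * far_kernel x q y + q `^ (- a) * test_fun x0 r y.
Proof.
move=> r0; have dx := l1_dist_ge0 x0 x; have dy := l1_dist_ge0 x0 y.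
have dxy := l1_dist_ge0 x y.
have q0 : 0 < q by rewrite /q; lra.
have tx := test_fun_ge0 x0 r x; have ty := test_fun_ge0 x0 r y.
rewrite /near_kernel /far_kernel; case: ltP => [dq|qd].
  rewrite mulr0 addr0; apply: ler_wpDr; first by rewrite mulr_ge0 ?powR_ge0.
  have tri1 := l1_dist_triangle y x0 x; have tri2 := l1_dist_triangle x x0 y.
  rewrite (l1_dist_sym y x) in tri1.
  have qx : q <= r + l1_dist x0 x by rewrite /q; lra.
  have qy : q <= r + l1_dist x0 y by move: dq; rewrite /q; lra.
  have an : 0 <= a <= N.+1%:R by rewrite -natr1 a_ge0/= lerD2l ltW.
  have := powRN_lipschitz q0 qx qy an; rewrite -/(test_fun x0 r x) -/(test_fun x0 r y).
  set L := N.+1%:R * q `^ (- a - 1); have L0 : 0 <= L.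
    by rewrite mulr_ge0 ?powR_ge0.
  move=> lip; have lip' : `|test_fun x0 r x - test_fun x0 r y| <= L * l1_dist x y.
    apply: (le_trans lip); apply: ler_wpM2l => //.
    by rewrite ler_norml; apply/andP; split; lra.
  apply: (le_trans (ler_wpM2r (powR_ge0 _ _) lip')).
  rewrite -mulrA; apply: ler_wpM2l => //.
  have [d0|d0] := leP (l1_dist x y) 0.
    by rewrite (_ : l1_dist x y = 0) ?mul0r ?powR_ge0//; lra.
  by rewrite powRD ?(gt_eqF d0) ?implybT// powRr1.
rewrite mulr0 add0r.
apply: (@le_trans _ _ ((test_fun x0 r x + test_fun x0 r y) * l1_dist x y `^ (- a))).
  apply: ler_wpM2r; first exact: powR_ge0.
  by rewrite ler_norml; apply/andP; split; lra.
rewrite mulrDl lerD2l [leRHS]mulrC; apply: ler_wpM2l => //.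
by apply: powR_opp_le => //; lra.
Qed.

Definition nonlocal_const : R := N%:R `^ a *
  (N.+1%:R * near_const * 2 `^ a * 2 `^ sigma + far_const * 2 `^ sigma +
   2 `^ a * far_const).

Lemma nonlocal_const_gt0 : 0 < nonlocal_const.
Proof.
have Np : 0 < N%:R :> R by rewrite ltr0n.
have nc := near_const_gt0; have fc := far_const_gt0.
have U0 : 0 < 2 `^ a :> R by exact: powR_gt0.
have V0 : 0 < 2 `^ sigma :> R by exact: powR_gt0.
apply: mulr_gt0; first exact: powR_gt0.
move: near_const far_const nc fc => c1 c2 c10 c20.
by apply: addr_gt0; [apply: addr_gt0|]; do ?apply: mulr_gt0.
Qed.

(** The integral is split at half the distance scale of [x]. Close to [x] the
    function is Lipschitz, and farther away the kernel is as small as the function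
    itself. *)
Lemma test_fun_nonlocal_le x0 r x : 0 < r ->
  (\int[mu]_y (`|test_fun x0 r x - test_fun x0 r y| * frac_kernel x y)%:E <=
   (nonlocal_const * r `^ (- sigma) * test_fun x0 r x)%:E)%E.
Proof.
move=> r0; have dx := l1_dist_ge0 x0 x.
pose q := (r + l1_dist x0 x) / 2; have q0 : 0 < q by rewrite /q; lra.
pose A := N%:R `^ a; have A0 : 0 <= A by exact: powR_ge0.
pose B := A * (N.+1%:R * q `^ (- a - 1)).
have B0 : 0 <= B by rewrite mulr_ge0// mulr_ge0 ?powR_ge0.
pose C := A * test_fun x0 r x; have C0 : 0 <= C by rewrite mulr_ge0 ?test_fun_ge0.
pose D := A * q `^ (- a); have D0 : 0 <= D by rewrite mulr_ge0 ?powR_ge0.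
have mt := measurable_test_fun x0 r.
have mK : measurable_fun setT (frac_kernel x).
  exact: (measurableT_comp measurable_frac_kernel (pair1_measurable x)).
have EM (c : R) (f : E -> R) : measurable_fun setT f ->
    measurable_fun setT (fun y => (c%:E * (f y)%:E)%E).
  by move=> mf; apply: measurable_funeM; exact/measurable_EFinP.
have mn := EM B _ (measurable_near_kernel x q).
have mf := EM C _ (measurable_far_kernel x q).
have mt' := EM D _ mt.
have n0 y : (0 <= B%:E * (near_kernel x q y)%:E)%E.
  by rewrite mule_ge0 ?lee_fin ?near_kernel_ge0.
have f0 y : (0 <= C%:E * (far_kernel x q y)%:E)%E.
  by rewrite mule_ge0 ?lee_fin ?far_kernel_ge0.
have t0 y : (0 <= D%:E * (test_fun x0 r y)%:E)%E.
  by rewrite mule_ge0 ?lee_fin ?test_fun_ge0.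
apply: (@le_trans _ _ (\int[mu]_y (B%:E * (near_kernel x q y)%:E +
    C%:E * (far_kernel x q y)%:E + D%:E * (test_fun x0 r y)%:E))%E).
  apply: ge0_le_integral => //.
  - by move=> y _; rewrite lee_fin mulr_ge0 ?frac_kernel_ge0.
  - apply/measurable_EFinP; apply: measurable_funM => //.
    by apply: measurableT_comp => //; exact: measurable_funB.
  - by apply: emeasurable_funD => //; exact: emeasurable_funD.
  - move=> y _; rewrite -!EFinM -!EFinD lee_fin.
    apply: (le_trans (ler_wpM2l (normr_ge0 _) (frac_kernel_le_l1 x y))).
    rewrite mulrCA /B /C /D -!mulrA -!mulrDr; apply: ler_wpM2l => //.
    by rewrite !mulrA; exact: test_fun_increment_le.
rewrite ge0_integralD//; [|by move=> y _; rewrite adde_ge0|exact: emeasurable_funD].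
rewrite ge0_integralD// !ge0_integralZl//; try by
  [apply/measurable_EFinP; exact: measurable_near_kernel
  |apply/measurable_EFinP; exact: measurable_far_kernel
  |exact/measurable_EFinP
  |move=> y _; rewrite lee_fin ?near_kernel_ge0 ?far_kernel_ge0 ?test_fun_ge0].
have bn := near_kernel_integral_le x q0; have bf := far_kernel_integral_le x q0.
have bt := test_fun_integral_le x0 r0.
have EC (c : R) : 0 <= c -> (0 <= c%:E)%E by rewrite lee_fin.
apply: (le_trans (leeD (leeD (lee_wpmul2l (EC _ B0) bn)
  (lee_wpmul2l (EC _ C0) bf)) (lee_wpmul2l (EC _ D0) bt))).
rewrite -!EFinM -!EFinD lee_fin.
have qa : q `^ (- a) = 2 `^ a * test_fun x0 r x.
  rewrite /test_fun /q powRM ?invr_ge0//; last lra.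
  by rewrite mulrC -powR_inv1// -powRrM mulN1r opprK.
have qs : q `^ (- sigma) <= 2 `^ sigma * r `^ (- sigma).
  have -> : 2 `^ sigma * r `^ (- sigma) = (r / 2) `^ (- sigma).
    rewrite powRM ?invr_ge0 ?(ltW r0)// mulrC -powR_inv1// -powRrM.
    by rewrite mulN1r opprK.
  by apply: powR_opp_le; rewrite ?(ltW sigma0) /q//; lra.
have qq : q `^ (- a - 1) * q `^ (1 - sigma) = q `^ (- a) * q `^ (- sigma).
  by rewrite -!powRD ?(gt_eqF q0) ?implybT//; congr (_ `^ _); ring.
have -> : B * (near_const * q `^ (1 - sigma)) =
    A * (N.+1%:R * near_const) * (q `^ (- a) * q `^ (- sigma)).
  by rewrite -qq /B; ring.
rewrite qa /C /D qa /nonlocal_const -/A.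
have t0x := test_fun_ge0 x0 r x.
have nc := near_const_gt0; have fc := far_const_gt0.
set t := test_fun x0 r x in t0x *; set S := q `^ (- sigma) in qs *.
set U := 2 `^ a; set V := 2 `^ sigma in qs *; set W := r `^ (- sigma) in qs *.
have U0 : 0 <= U by exact: powR_ge0.
have h1 : A * (N.+1%:R * near_const) * (U * t * S) <=
    A * (N.+1%:R * near_const) * (U * t * (V * W)).
  apply: ler_wpM2l.
    by apply: mulr_ge0 => //; apply: mulr_ge0 => //; exact: ltW.
  by apply: ler_wpM2l => //; rewrite mulr_ge0.
have h2 : A * t * (far_const * S) <= A * t * (far_const * (V * W)).
  apply: ler_wpM2l; first by rewrite mulr_ge0.
  by apply: ler_wpM2l => //; exact: ltW.
apply: (le_trans (lerD (lerD h1 h2) (lexx _))).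
by rewrite le_eqVlt; apply/orP; left; apply/eqP; ring.
Qed.

End order.
End test_function.

(** * The energy and its subdifferential *)

Section ge0_integral_real.
Context d (T : measurableType d) (R : realType).
Variable mu : {measure set T -> \bar R}.
Implicit Types (f g : T -> R) (c : R).

Definition ge0_mfun f := measurable_fun setT f /\ forall x, 0 <= f x.

Lemma ge0_mfunD f g : ge0_mfun f -> ge0_mfun g -> ge0_mfun (fun x => f x + g x).
Proof.
move=> [mf f0] [mg g0]; split; first exact: measurable_funD.
by move=> x; rewrite addr_ge0.
Qed.

Lemma ge0_mfunZ c f : 0 <= c -> ge0_mfun f -> ge0_mfun (fun x => c * f x).
Proof.
move=> c0 [mf f0]; split; first exact: measurable_funM.
by move=> x; rewrite mulr_ge0.
Qed.

Lemma ge0_mfun_integral_ge0 f : ge0_mfun f -> (0 <= \int[mu]_x (f x)%:E)%E.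
Proof. by move=> [_ f0]; apply: integral_ge0 => x _; rewrite lee_fin. Qed.

Lemma ge0_mfun_integralD f g : ge0_mfun f -> ge0_mfun g ->
  (\int[mu]_x (f x + g x)%:E = \int[mu]_x (f x)%:E + \int[mu]_x (g x)%:E)%E.
Proof.
move=> [mf f0] [mg g0]; rewrite -ge0_integralD//.
- by move=> x _; rewrite lee_fin.
- exact/measurable_EFinP.
- by move=> x _; rewrite lee_fin.
- exact/measurable_EFinP.
Qed.

Lemma ge0_mfun_integralZ c f : 0 <= c -> ge0_mfun f ->
  (\int[mu]_x (c * f x)%:E = c%:E * \int[mu]_x (f x)%:E)%E.
Proof.
move=> c0 [mf f0]; rewrite -ge0_integralZl//.
- exact/measurable_EFinP.
- by move=> x _; rewrite lee_fin.
Qed.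

Lemma ge0_mfun_le_integral f g : ge0_mfun f -> ge0_mfun g ->
  (forall x, f x <= g x) -> (\int[mu]_x (f x)%:E <= \int[mu]_x (g x)%:E)%E.
Proof.
move=> [mf f0] [mg g0] fg; apply: ge0_le_integral => //.
- by move=> x _; rewrite lee_fin.
- exact/measurable_EFinP.
- exact/measurable_EFinP.
- by move=> x _; rewrite lee_fin.
Qed.

End ge0_integral_real.

Section energy_inequalities.
Context {R : realType} {N : nat}.
Local Notation E := (N.-tuple R).
Local Notation mu := (@leb R N).
Local Notation L2 := (Lfun mu 2%:E).
Implicit Types (f g v : E -> R) (s p q h sigma : R).

Definition incr_form sigma q f (z : E * E) : R :=
  `|f z.1 - f z.2| `^ q * @frac_kernel R N sigma z.1 z.2.

Definition pair_form sigma q f g (z : E * E) : R :=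
  `|g z.1 - g z.2| * `|f z.1 - f z.2| `^ q * @frac_kernel R N sigma z.1 z.2.

Lemma measurable_increment f : measurable_fun setT f ->
  measurable_fun setT (fun z : E * E => `|f z.1 - f z.2|).
Proof.
move=> mf; apply: measurableT_comp => //; apply: measurable_funB.
- exact: (measurableT_comp mf measurable_fst).
- exact: (measurableT_comp mf measurable_snd).
Qed.

Lemma incr_form_ge0_mfun sigma q f : measurable_fun setT f ->
  ge0_mfun (incr_form sigma q f).
Proof.
move=> mf; split; last by move=> z; rewrite mulr_ge0 ?powR_ge0 ?frac_kernel_ge0.
apply: measurable_funM; last exact: measurable_frac_kernel.
exact: (measurableT_comp (measurable_powR _) (measurable_increment mf)).
Qed.

Lemma pair_form_ge0_mfun sigma q f g : measurable_fun setT f ->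
  measurable_fun setT g -> ge0_mfun (pair_form sigma q f g).
Proof.
move=> mf mg; split.
  apply: measurable_funM; last exact: measurable_frac_kernel.
  apply: measurable_funM; first exact: measurable_increment.
  exact: (measurableT_comp (measurable_powR _) (measurable_increment mf)).
by move=> z; rewrite mulr_ge0 ?frac_kernel_ge0// mulr_ge0 ?powR_ge0.
Qed.

Lemma iterated_integralE (F : E * E -> R) : ge0_mfun F ->
  (\int[mu]_x \int[mu]_y (F (x, y))%:E = \int[mu \x mu]_z (F z)%:E)%E.
Proof.
move=> [mF F0]; apply/esym.
apply: (@fubini_tonelli1 _ _ _ _ _ mu mu (fun z => (F z)%:E)).
- exact/measurable_EFinP.
- by move=> z; rewrite lee_fin.
Qed.

Lemma energyE s p f : measurable_fun setT f -> energy s p f =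
  (((2 * p)^-1)%:E * \int[mu \x mu]_z (incr_form (s * p) p f z)%:E)%E.
Proof.
move=> mf; rewrite -iterated_integralE//.
exact: incr_form_ge0_mfun.
Qed.

Lemma energy_ge0 s p f : 0 <= p -> (0 <= energy s p f)%E.
Proof.
move=> p0; apply: mule_ge0; first by rewrite lee_fin invr_ge0 mulr_ge0.
apply: integral_ge0 => x _; apply: integral_ge0 => y _.
by rewrite lee_fin divr_ge0 ?powR_ge0.
Qed.

Lemma energy0 s p : p != 0 -> energy s p (fun _ : E => 0) = 0%E.
Proof.
move=> p0; rewrite /energy integral0_eq ?mule0// => x _.
by apply: integral0_eq => y _; rewrite subrr normr0 powR0// mul0r.
Qed.

Lemma energy_min_max s p f g : 1 <= p ->
  measurable_fun setT f -> measurable_fun setT g ->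
  (energy s p (fun x => Num.min (f x) (g x)) +
   energy s p (fun x => Num.max (f x) (g x)) <= energy s p f + energy s p g)%E.
Proof.
move=> p1 mf mg.
have mm : measurable_fun setT (fun x => Num.min (f x) (g x)) by exact: measurable_minr.
have mM : measurable_fun setT (fun x => Num.max (f x) (g x)) by exact: measurable_maxr.
have If := incr_form_ge0_mfun (s * p) p mf.
have Ig := incr_form_ge0_mfun (s * p) p mg.
have Im := incr_form_ge0_mfun (s * p) p mm.
have IM := incr_form_ge0_mfun (s * p) p mM.
have pf := ge0_mfun_integral_ge0 (mu \x mu)%E If.
have pg := ge0_mfun_integral_ge0 (mu \x mu)%E Ig.
have pm := ge0_mfun_integral_ge0 (mu \x mu)%E Im.
have pM := ge0_mfun_integral_ge0 (mu \x mu)%E IM.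
rewrite (energyE s p mf) (energyE s p mg) (energyE s p mm) (energyE s p mM).
rewrite -(ge0_muleDr _ pm pM) -(ge0_muleDr _ pf pg).
apply: lee_wpmul2l; first by rewrite lee_fin invr_ge0; lra.
rewrite -(ge0_mfun_integralD _ Im IM) -(ge0_mfun_integralD _ If Ig).
apply: (ge0_mfun_le_integral _ (ge0_mfunD Im IM) (ge0_mfunD If Ig)) => z.
rewrite /incr_form -!mulrDl.
by apply: ler_wpM2r; [exact: frac_kernel_ge0|exact: norm_powR_min_max].
Qed.

Lemma energy_perturb_le s p f g h : 1 < p <= 2 -> 0 < h ->
  measurable_fun setT f -> measurable_fun setT g ->
  (energy s p (fun x => (f x + h * g x)%R) <= energy s p f + h%:E *
   (\int[mu \x mu]_z (pair_form (s * p) (p - 1) f g z)%:E +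
    (h `^ (p - 1))%:E * \int[mu \x mu]_z (incr_form (s * p) p g z)%:E))%E.
Proof.
move=> p12 h0 mf mg; have /andP[p1 p2] := p12.
have mfg : measurable_fun setT (fun x => f x + h * g x).
  by apply: measurable_funD => //; exact: measurable_funM.
have c0 : 0 <= (2 * p)^-1 by rewrite invr_ge0; lra.
have h20 : 0 <= 2 * h by lra.
have hp0 : 0 <= h `^ (p - 1) by exact: powR_ge0.
have If := incr_form_ge0_mfun (s * p) p mf.
have Ig := incr_form_ge0_mfun (s * p) p mg.
have Ifg := incr_form_ge0_mfun (s * p) p mfg.
have Pfg := pair_form_ge0_mfun (s * p) (p - 1) mf mg.
have hIg := ge0_mfunZ hp0 Ig; have Q := ge0_mfunD Pfg hIg; have hQ := ge0_mfunZ h20 Q.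
have F0 := ge0_mfun_integral_ge0 (mu \x mu)%E If.
have S0 := ge0_mfun_integral_ge0 (mu \x mu)%E Q.
have hS0 := ge0_mfun_integral_ge0 (mu \x mu)%E hQ.
rewrite (energyE s p mf) (energyE s p mfg).
rewrite -(ge0_mfun_integralZ _ hp0 Ig) -(ge0_mfun_integralD _ Pfg hIg).
apply: (@le_trans _ _ (((2 * p)^-1)%:E * (\int[mu \x mu]_z (incr_form (s * p) p f z)%:E +
    \int[mu \x mu]_z (2 * h * (pair_form (s * p) (p - 1) f g z +
      h `^ (p - 1) * incr_form (s * p) p g z))%:E)))%E.
  apply: lee_wpmul2l; first by rewrite lee_fin.
  rewrite -(ge0_mfun_integralD _ If hQ).
  apply: (ge0_mfun_le_integral _ Ifg (ge0_mfunD If hQ)) => z.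
  rewrite /incr_form /pair_form.
  have k0 := @frac_kernel_ge0 R N (s * p) z.1 z.2.
  have := norm_powR_perturb (f z.1 - f z.2) (g z.1 - g z.2) h0 p12.
  rewrite (_ : f z.1 - f z.2 + h * (g z.1 - g z.2) =
    f z.1 + h * g z.1 - (f z.2 + h * g z.2)); last by ring.
  move=> /(ler_wpM2r k0) /le_trans; apply.
  by rewrite le_eqVlt; apply/orP; left; apply/eqP; ring.
rewrite (ge0_muleDr _ F0 hS0) leeD2l// (ge0_mfun_integralZ _ h20 Q) muleA -EFinM.
apply: lee_wpmul2r => //; rewrite lee_fin.
rewrite (_ : (2 * p)^-1 * (2 * h) = h / p); last by field; lra.
by rewrite ler_pdivrMr ?ler_peMr//; lra.
Qed.

Lemma subdifferential_energy_lty s p f g : 0 < p -> subdifferential s p f g ->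
  (energy s p f < +oo)%E.
Proof.
move=> p0 [fL gL sub].
have zL : (fun=> 0 : R) \in L2.
  by rewrite (_ : (fun=> 0) = fun x => f x - f x) ?L2B//; apply/funext => x; rewrite subrr.
have := sub _ zL; rewrite energy0 ?gt_eqF//.
set I := (\int[mu]_x _)%E.
have : I \is a fin_num.
  by apply: integrable_fin_num => //; apply: L2_mul_integrable => //; exact: L2B.
case: I => // i _.
by case: (energy s p f) (energy_ge0 s f (ltW p0)) => [r| |]//; rewrite ltry.
Qed.

Lemma subdifferential_inequality s p f g v : 0 < p -> subdifferential s p f g ->
  v \in L2 -> (energy s p v < +oo)%E ->
  fine (energy s p f) + \int[mu]_x (g x * (v x - f x)) <= fine (energy s p v).
Proof.
move=> p0 sfg vL vfin; have ffin := subdifferential_energy_lty p0 sfg.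
have fe (u : E -> R) : (energy s p u < +oo)%E -> energy s p u = (fine (energy s p u))%:E.
  by move=> ufin; rewrite fineK// ge0_fin_numE//; exact: (energy_ge0 s u (ltW p0)).
have [fL gL /(_ _ vL)] := sfg.
rewrite (fe _ ffin) (fe _ vfin) -lee_fin EFinD /Rintegral (fineK (x := \int[mu]_x _)%E)//.
by apply: integrable_fin_num => //; apply: L2_mul_integrable => //; exact: L2B.
Qed.

(** Testing the inequality at [f1] with the minimum of [f1] and [f2], and the one
    at [f2] with their maximum, the energies cancel by submodularity. *)
Lemma subdifferential_T_monotone s p f1 f2 g1 g2 : 1 <= p ->
  subdifferential s p f1 g1 -> subdifferential s p f2 g2 ->
  0 <= \int[mu]_x (pospart (fun x => f1 x - f2 x) x * (g1 x - g2 x)).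
Proof.
move=> p1 s1 s2; have p0 : 0 < p by lra.
have [f1L g1L _] := s1; have [f2L g2L _] := s2.
pose w := pospart (fun x => f1 x - f2 x).
have wL : w \in L2 by apply: L2_pospart; exact: L2B.
have minE : (fun x => Num.min (f1 x) (f2 x)) = (fun x => f1 x - w x).
  apply/funext => x; rewrite /w /pospart.
  by case: (leP (f1 x) (f2 x)); case: (leP (f1 x - f2 x) 0); lra.
have maxE : (fun x => Num.max (f1 x) (f2 x)) = (fun x => f2 x + w x).
  apply/funext => x; rewrite /w /pospart.
  by case: (leP (f1 x) (f2 x)); case: (leP (f1 x - f2 x) 0); lra.
have := energy_min_max s p1 (L2_measurable f1L) (L2_measurable f2L).
rewrite minE maxE => mm.
have e1 := subdifferential_energy_lty p0 s1; have e2 := subdifferential_energy_lty p0 s2.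
have pos (u : E -> R) : (0 <= energy s p u)%E by exact: (energy_ge0 s u (ltW p0)).
have sfin := lte_add_pinfty e1 e2.
have [posm posM] := (pos (fun x => f1 x - w x), pos (fun x => f2 x + w x)).
have mfin := le_lt_trans (le_trans (leeDl _ posM) mm) sfin.
have Mfin := le_lt_trans (le_trans (leeDr _ posm) mm) sfin.
have lt1 := subdifferential_inequality p0 s1 (L2B f1L wL) mfin.
have lt2 := subdifferential_inequality p0 s2 (L2D f2L wL) Mfin.
have sum_le : fine (energy s p (fun x => f1 x - w x)) +
    fine (energy s p (fun x => f2 x + w x)) <=
    fine (energy s p f1) + fine (energy s p f2).
  move: mm posm posM (pos f1) (pos f2) e1 e2 mfin Mfin.
  move: (energy s p f1) (energy s p f2) (energy s p _) (energy s p _).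
  by move=> [a| |] [b| |] [c| |] [d| |].
have E2 : \int[mu]_x (g2 x * (f2 x + w x - f2 x)) = \int[mu]_x (w x * g2 x).
  by apply: eq_Rintegral => x _; ring.
have E1 : \int[mu]_x (g1 x * (f1 x - w x - f1 x)) = - \int[mu]_x (w x * g1 x).
  rewrite -mulN1r -RintegralZl//; last exact: L2_mul_integrable.
  by apply: eq_Rintegral => x _; ring.
rewrite E1 in lt1; rewrite E2 in lt2.
have -> : \int[mu]_x (w x * (g1 x - g2 x)) =
    \int[mu]_x (w x * g1 x) - \int[mu]_x (w x * g2 x).
  rewrite -RintegralB//; try exact: L2_mul_integrable.
  by apply: eq_Rintegral => x _; ring.
have cancel_energies (a b c e I J : R) :
    a + - I <= c -> b + J <= e -> c + e <= a + b -> 0 <= I - J.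
  by clear; lra.
exact: cancel_energies lt1 lt2 sum_le.
Qed.

End energy_inequalities.

Section pairing.
Context {R : realType} {N : nat}.
Local Notation E := (N.-tuple R).
Local Notation mu := (@leb R N).
Local Notation L2 := (Lfun mu 2%:E).
Implicit Types (f g w : E -> R) (s p q h sigma B l : R).

(** The nonlocal operator, without cancellation, maps [w] below a multiple of
    itself. *)
Definition nonlocal_bound sigma B w : Prop := forall x,
  (\int[mu]_y (`|w x - w y| * @frac_kernel R N sigma x y)%:E <= (B * w x)%:E)%E.

(** The power of an increment of [f] is at most the sum of the powers at its two
    ends, and these contribute equally by symmetry of the kernel. *)
Lemma pair_form_integral_le sigma q B f w : 0 <= q <= 1 -> 0 <= B ->
  measurable_fun setT f -> ge0_mfun w -> nonlocal_bound sigma B w ->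
  (\int[mu \x mu]_z (pair_form sigma q f w z)%:E <=
   (2 * B)%:E * \int[mu]_x (`|f x| `^ q * w x)%:E)%E.
Proof.
move=> q01 B0 mf wp bound; have [mw w0] := wp.
pose D (z : E * E) := `|w z.1 - w z.2| * @frac_kernel R N sigma z.1 z.2.
have Dsym x y : D (x, y) = D (y, x) by rewrite /D/= distrC frac_kernel_sym.
have D0 z : 0 <= D z by rewrite mulr_ge0 ?frac_kernel_ge0.
have mD : measurable_fun setT D.
  by apply: measurable_funM; [exact: measurable_increment|exact: measurable_frac_kernel].
pose fq x := `|f x| `^ q.
have mfq : measurable_fun setT fq.
  by apply: (measurableT_comp (measurable_powR _)); exact: measurableT_comp.
have fq0 x : 0 <= fq x by exact: powR_ge0.
have pos1 : ge0_mfun (fun z : E * E => fq z.1 * D z).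
  split; last by move=> z; rewrite mulr_ge0.
  by apply: measurable_funM => //; exact: (measurableT_comp mfq measurable_fst).
have pos2 : ge0_mfun (fun z : E * E => fq z.2 * D z).
  split; last by move=> z; rewrite mulr_ge0.
  by apply: measurable_funM => //; exact: (measurableT_comp mfq measurable_snd).
have posw : ge0_mfun (fun x => fq x * w x).
  by split; [exact: measurable_funM|move=> x; rewrite mulr_ge0].
have sliceD x : ge0_mfun (fun y => D (x, y)).
  by split => //; exact: (measurableT_comp mD (pair1_measurable x)).
have slice x : (\int[mu]_y (fq x * D (x, y))%:E <= (B * (fq x * w x))%:E)%E.
  rewrite ge0_mfun_integralZ//.
  apply: (@le_trans _ _ ((fq x)%:E * (B * w x)%:E)%E).
    by apply: lee_wpmul2l; [rewrite lee_fin|exact: bound].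
  by rewrite -EFinM mulrCA.
have mslice (F : E * E -> R) : ge0_mfun F ->
    measurable_fun setT (fun x => (\int[mu]_y (F (x, y))%:E)%E).
  move=> [mF F0].
  apply: (@measurable_fun_fubini_tonelli_F _ _ _ _ _ mu (fun z => (F z)%:E)).
    exact/measurable_EFinP.
  by move=> z; rewrite lee_fin.
have fst_le : (\int[mu \x mu]_z (fq z.1 * D z)%:E <=
    B%:E * \int[mu]_x (fq x * w x)%:E)%E.
  rewrite -iterated_integralE// -ge0_mfun_integralZ//.
  apply: ge0_le_integral => //.
  - move=> x _; apply: integral_ge0 => y _; rewrite lee_fin; exact: (proj2 pos1 (x, y)).
  - exact: mslice pos1.
  - by apply/measurable_EFinP; apply: measurable_funM => //; exact: (proj1 posw).
  - by move=> x _; exact: slice.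
have snd_le : (\int[mu \x mu]_z (fq z.2 * D z)%:E <=
    B%:E * \int[mu]_x (fq x * w x)%:E)%E.
  have mF : measurable_fun setT (fun z : E * E => (fq z.2 * D z)%:E).
    by apply/measurable_EFinP; exact: (proj1 pos2).
  have F0 (z : E * E) : (0 <= (fq z.2 * D z)%:E)%E.
    by rewrite lee_fin; exact: (proj2 pos2 z).
  rewrite (@fubini_tonelli2 _ _ _ _ _ mu mu _ mF F0); apply: (le_trans _ fst_le).
  rewrite -(iterated_integralE pos1) le_eqVlt; apply/orP; left; apply/eqP.
  apply: eq_integral => y _; apply: eq_integral => x _.
  by rewrite /= Dsym.
have split_le : (\int[mu \x mu]_z (pair_form sigma q f w z)%:E <=
    \int[mu \x mu]_z (fq z.1 * D z + fq z.2 * D z)%:E)%E.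
  apply: (ge0_mfun_le_integral _ (pair_form_ge0_mfun sigma q mf mw)
    (ge0_mfunD pos1 pos2)) => z.
  rewrite /pair_form -mulrDl mulrAC mulrC -/(D z); apply: ler_wpM2r => //.
  have /andP[q0 q1] := q01.
  apply: (@le_trans _ _ ((`|f z.1| + `|f z.2|) `^ q)); last exact: powR_subadd.
  by apply: ge0_ler_powR; rewrite ?nnegrE ?addr_ge0 ?ler_normB.
apply: (le_trans split_le); rewrite ge0_mfun_integralD//.
apply: (le_trans (leeD fst_le snd_le)).
rewrite -ge0_muleDl ?lee_fin// -EFinD; set I := integral _ _ _.
by rewrite (_ : B + B = 2 * B)//; ring.
Qed.

(** For a bounded weight, the powers of the increments of order [p] reduce to
    their first powers, controlled by the nonlocal bound. *)
Lemma energy_weight_lty s p B m w : 1 < p <= 2 -> 0 <= B ->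
  ge0_mfun w -> (forall x, w x <= m) -> nonlocal_bound (s * p) B w ->
  (\int[mu]_x (w x)%:E < +oo)%E ->
  (\int[mu \x mu]_z (incr_form (s * p) p w z)%:E < +oo)%E.
Proof.
move=> /andP[p1 p2] B0 wp wm bound fin; have [mw w0] := wp.
have -> : incr_form (s * p) p w = pair_form (s * p) (p - 1) w w.
  apply/funext => z; rewrite /incr_form /pair_form; congr (_ * _).
  by rewrite mulr_powRB1//; lra.
have q01 : 0 <= p - 1 <= 1 by apply/andP; split; lra.
apply: (le_lt_trans (pair_form_integral_le q01 B0 mw wp bound)).
have m0 : 0 <= m by apply: le_trans (w0 [tuple of nseq N 0]) (wm _).
have mp0 : 0 <= m `^ (p - 1) by exact: powR_ge0.
apply: (@le_lt_trans _ _ ((2 * B)%:E * ((m `^ (p - 1))%:E * \int[mu]_x (w x)%:E))%E).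
  apply: lee_wpmul2l; first by rewrite lee_fin mulr_ge0.
  rewrite -ge0_mfun_integralZ//; apply: ge0_mfun_le_integral.
  - split; last by move=> x; rewrite mulr_ge0 ?powR_ge0.
    apply: measurable_funM => //; apply: (measurableT_comp (measurable_powR _)).
    exact: measurableT_comp.
  - exact: ge0_mfunZ.
  - move=> x; apply: ler_wpM2r => //.
    by apply: ge0_ler_powR; rewrite ?nnegrE ?(ger0_norm (w0 x))//; lra.
have : (0 <= \int[mu]_x (w x)%:E)%E by exact: ge0_mfun_integral_ge0.
by case: (\int[mu]_x (w x)%:E)%E fin => // r _ _; rewrite -!EFinM ltry.
Qed.

(** This is the weak form of the equation, as an inequality. Testing the
    subgradient at [f + h * w] and letting [h] tend to zero bounds the pairing by
    the double integral of the increments of [w] against the powers [p - 1] of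
    those of [f]; the cost [h `^ (p - 1)] of the energy of [w] disappears. The
    powers are then linearised at the level [l]. *)
Lemma subdifferential_pairing_le s p B m l f g w : 1 < p <= 2 -> 0 <= B ->
  0 < l -> subdifferential s p f g -> {ae mu, forall x, 0 <= f x} ->
  w \in L2 -> (forall x, 0 <= w x <= m) -> nonlocal_bound (s * p) B w ->
  mu.-integrable setT (EFin \o w) ->
  \int[mu]_x (w x * g x) <=
    2 * B * l `^ (p - 2) * (\int[mu]_x (w x * f x) + l * \int[mu]_x w x).
Proof.
move=> p12 B0 l0 sfg f0 wL wm bound wI; have /andP[p1 p2] := p12.
have p0 : 0 < p by lra.
have [fL gL _] := sfg.
have mf := L2_measurable fL; have mw := L2_measurable wL.
have wp : ge0_mfun w by split => // x; case/andP: (wm x).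
have q01 : 0 <= p - 1 <= 1 by apply/andP; split; lra.
have wfin : (\int[mu]_x (w x)%:E < +oo)%E.
  have /integrableP[_] := wI; apply: le_lt_trans.
  apply: ge0_le_integral => //.
  - by move=> x _; rewrite lee_fin; case/andP: (wm x).
  - exact/measurable_EFinP.
  - by apply: measurableT_comp => //; exact/measurable_EFinP.
  - by move=> x _; rewrite /= lee_fin ler_norm.
have wmax x : w x <= m by case/andP: (wm x).
have I2fin := energy_weight_lty p12 B0 wp wmax bound wfin.
have I2ge := ge0_mfun_integral_ge0 (mu \x mu)%E (incr_form_ge0_mfun (s * p) p mw).
have I1ge := ge0_mfun_integral_ge0 (mu \x mu)%E (pair_form_ge0_mfun (s * p) (p - 1) mf mw).
have wfI : mu.-integrable setT (EFin \o (fun x => w x * f x)).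
  exact: L2_mul_integrable.
have nfI : mu.-integrable setT (EFin \o (fun x => `|f x| * w x)).
  apply: eq_integrable (integrable_norm wfI) => // x _ /=.
  by rewrite normrM (ger0_norm (proj2 wp x)) mulrC.
have absE : \int[mu]_x (`|f x| * w x) = \int[mu]_x (w x * f x).
  congr fine; apply: ae_eq_integral => //; [exact: measurable_int nfI| |].
    exact: measurable_int wfI.
  by apply: filterS f0 => x fx _ /=; rewrite ger0_norm// mulrC.
set X := \int[mu]_x (w x * f x) in absE *; set W := \int[mu]_x w x.
have powle : (\int[mu]_x (`|f x| `^ (p - 1) * w x)%:E <=
    (l `^ (p - 2) * (X + l * W))%:E)%E.
  apply: (@le_trans _ _ (\int[mu]_x (l `^ (p - 2) * (`|f x| * w x + l * w x))%:E)%E).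
    have lin : ge0_mfun (fun x => `|f x| * w x + l * w x).
      apply: ge0_mfunD; last by apply: ge0_mfunZ => //; exact: ltW.
      split; last by move=> x; rewrite mulr_ge0// (proj2 wp).
      by apply: measurable_funM => //; exact: measurableT_comp.
    apply: ge0_mfun_le_integral.
    - split; last by move=> x; rewrite mulr_ge0 ?powR_ge0 ?(proj2 wp).
      apply: measurable_funM => //; apply: (measurableT_comp (measurable_powR _)).
      exact: measurableT_comp.
    - by apply: ge0_mfunZ => //; exact: powR_ge0.
    - move=> x; have := powR_le_affine (normr_ge0 (f x)) l0 q01.
      rewrite (_ : p - 1 - 1 = p - 2); last by ring.
      rewrite (_ : l `^ (p - 1) = l `^ (p - 2) * l).
        move=> /(ler_wpM2r (proj2 wp x)) /le_trans; apply.
        by rewrite le_eqVlt; apply/orP; left; apply/eqP; ring.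
      rewrite -[X in _ * X](powRr1 (ltW l0)) -powRD ?(gt_eqF l0) ?implybT//.
      by congr (_ `^ _); ring.
  have lwI : mu.-integrable setT (EFin \o (fun x => l * w x)).
    exact: (integrableZl _ l wI).
  have sumI : mu.-integrable setT (EFin \o (fun x => `|f x| * w x + l * w x)).
    exact: (integrableD _ nfI lwI).
  have totI : mu.-integrable setT
      (EFin \o (fun x => l `^ (p - 2) * (`|f x| * w x + l * w x))).
    exact: (integrableZl _ (l `^ (p - 2)) sumI).
  rewrite -(fineK (integrable_fin_num measurableT totI)) lee_fin.
  rewrite -/(Rintegral _ _ _) RintegralZl// RintegralD// RintegralZl//.
  by rewrite absE.
have pairle := pair_form_integral_le q01 B0 mf wp bound.
have {powle}I1le : (\int[mu \x mu]_z (pair_form (s * p) (p - 1) f w z)%:E <=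
    (2 * B * (l `^ (p - 2) * (X + l * W)))%:E)%E.
  apply: (le_trans pairle); rewrite [in leRHS]EFinM; apply: lee_wpmul2l => //.
  by rewrite lee_fin mulr_ge0.
rewrite -mulrA; set Q := 2 * B * _ in I1le *.
have ffin := subdifferential_energy_lty p0 sfg.
have fpos := energy_ge0 s f (ltW p0).
have fineE (x : \bar R) : (0 <= x)%E -> (x < +oo)%E -> x = (fine x)%:E.
  by move=> x0 xfin; rewrite fineK// ge0_fin_numE.
have fE := fineE _ fpos ffin; have I2E := fineE _ I2ge I2fin.
have combine (x a b c : \bar R) (a' c' k k' r : R) :
    (x <= a + k%:E * (b + k'%:E * c))%E -> (b <= r%:E)%E -> a = a'%:E ->
    c = c'%:E -> 0 <= k -> (x <= (a' + k * (r + k' * c'))%:E)%E.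
  move=> + br aE cE k0; rewrite aE cE => /le_trans; apply; rewrite EFinD EFinM EFinD EFinM.
  apply: leeD2l; apply: lee_wpmul2l; first by rewrite lee_fin.
  exact: leeD2r.
have step h : 0 < h -> \int[mu]_x (w x * g x) <= Q + h `^ (p - 1) *
    fine (\int[mu \x mu]_z (incr_form (s * p) p w z)%:E).
  move=> h0; have vL := L2D fL (L2Z h wL).
  have pert := energy_perturb_le s p12 h0 mf mw.
  have vpos := energy_ge0 s (fun x => f x + h * w x) (ltW p0).
  have hp : (0 <= (h `^ (p - 1))%:E)%E by rewrite lee_fin powR_ge0.
  have : (energy s p (fun x => (f x + h * w x)%R) <= (fine (energy s p f) + h *
      (Q + h `^ (p - 1) * fine (\int[mu \x mu]_z (incr_form (s * p) p w z)%:E)))%:E)%E.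
    exact: (combine _ _ _ _ _ _ _ _ _ pert I1le fE I2E (ltW h0)).
  move=> vle; have vfin := le_lt_trans vle (ltry _).
  have := subdifferential_inequality p0 sfg vL vfin.
  have -> : \int[mu]_x (g x * (f x + h * w x - f x)) = h * \int[mu]_x (w x * g x).
    rewrite -RintegralZl//; last exact: L2_mul_integrable.
    by apply: eq_Rintegral => x _; ring.
  have : fine (energy s p (fun x => f x + h * w x)) <= fine (energy s p f) + h *
      (Q + h `^ (p - 1) * fine (\int[mu \x mu]_z (incr_form (s * p) p w z)%:E)).
    by rewrite -lee_fin -(fineE _ vpos vfin).
  move=> v1 v2.
  have cancel_energy (a b c e : R) : a <= b + h * c -> b + h * e <= a -> e <= c.
    by clear -h0 => ab ba; rewrite -(ler_pM2l h0); lra.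
  exact: cancel_energy v1 v2.
set I := fine _ in step.
have I0 : 0 <= I by exact: fine_ge0.
(* The choice of [h] makes [h `^ (p - 1) * I] smaller than [e]. *)
apply/ler_addgt0Pr => e e0.
have k0 : 0 < e / (I + 1) by rewrite divr_gt0//; lra.
have h0 : 0 < (e / (I + 1)) `^ (p - 1)^-1 by exact: powR_gt0.
apply: (le_trans (step _ h0)); rewrite lerD2l -powRrM mulVf ?powRr1 ?(ltW k0)//; last lra.
rewrite mulrAC -mulrA -[leRHS]mulr1 ler_pM2l// ler_pdivrMr; lra.
Qed.

End pairing.

(** * Comparison and backward estimates for the semigroup *)

Section semigroup.
Context {R : realType} {N : nat}.
Local Notation E := (N.-tuple R).
Local Notation mu := (@leb R N).
Local Notation L2 := (Lfun mu 2%:E).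
Implicit Types (f g v : E -> R) (w : R -> E -> R) (s p r t T : R).

Lemma norm2E f : f \in L2 -> norm2 f = (l2norm mu f)%:E.
Proof. exact: L2norm_fin. Qed.

Lemma cvge0_near_lt (U : Type) (F : set_system U) {FF : Filter F}
    (h : U -> \bar R) (e : R) : h x @[x --> F] --> 0%E -> 0 < e ->
  \forall x \near F, (h x < e%:E)%E.
Proof.
move=> hF e0; apply: (hF [set y | (y < e%:E)%E]).
by apply: open_nbhs_nbhs; split; [exact: open_ereal_lt_ereal|rewrite /= lte_fin].
Qed.

Lemma L2_semigroup_curve s p v w : L2_semigroup s p v w -> L2_curve mu w.
Proof.
move=> [_ wL wc wlip _]; split => //.
- move=> e e0.
  have FF : Filter (within `[0, +oo[ (nbhs (0 : R))) by exact: within_filter.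
  have lt_e := cvge0_near_lt (FF := FF) (wc 0 (lexx 0)) e0.
  have [r /= r0 hr] := (nbhs_ballP _ _).1 lt_e; exists r => // t /andP[t0 tr].
  have dL : (fun x => w t x - w 0 x) \in L2 by apply: L2B; apply: wL; rewrite // ltW.
  rewrite -lee_fin -norm2E//; apply/ltW; apply: hr; last first.
    by rewrite /= in_itv/= ltW.
  by rewrite /ball/= sub0r normrN gtr0_norm.
- move=> r r0; have [K hK] := wlip _ r0; exists K => t1 t2 r1 r2.
  have dL : (fun x => w t1 x - w t2 x) \in L2.
    by apply: L2B; apply: wL; apply: le_trans (ltW r0) _.
  by rewrite -lee_fin -norm2E//; exact: hK.
Qed.

Lemma L2_derivative_right w t g : (forall t, 0 <= t -> w t \in L2) -> 0 <= t ->
  g \in L2 -> L2_derivative w t g -> L2_right_derivative mu w t g.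
Proof.
move=> wL t0 gL dw e e0; have FF : Filter ((0 : R)^') by exact: within_filter.
have lt_e := cvge0_near_lt (FF := FF) dw e0.
have [r /= r0 hr] := (nbhs_ballP _ _).1 lt_e.
exists r => // h /andP[h0 hlt].
have th0 : 0 <= t + h by rewrite addr_ge0// ltW.
have dL := L2B (wL _ th0) (wL _ t0).
have qL : (fun x => (w (t + h) x - w t x) / h - g x) \in L2.
  apply: L2B => //.
  rewrite (_ : (fun x => _) = fun x => h^-1 * (w (t + h) x - w t x)) ?L2Z//.
  by apply/funext => x; rewrite mulrC.
have : (norm2 (fun x => ((w (t + h) x - w t x) / h - g x)%R) < e%:E)%E.
  apply: hr; first by rewrite /ball/= sub0r normrN gtr0_norm.
  by rewrite gt_eqF.
rewrite norm2E// lte_fin => /ltW qe.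
rewrite (_ : (fun x => _) = fun x => h * ((w (t + h) x - w t x) / h - g x)).
  by rewrite l2normZ// gtr0_norm// mulrC ler_pM2r.
by apply/funext => x; rewrite mulrBr mulrCA divff ?gt_eqF// mulr1.
Qed.

Lemma L2_semigroup_right_derivative s p v w : L2_semigroup s p v w ->
  {ae @lebesgue_measure R, forall t, 0 < t -> exists g,
    [/\ g \in L2, L2_right_derivative mu w t g &
        subdifferential s p (w t) (fun x => - g x)]}.
Proof.
move=> [_ wL _ _ deriv].
apply: (@filterS _ _ (ae_filter_ringOfSetsType _) _ _ _ deriv) => t dt t0.
have [g [dg sg]] := dt t0; have [_ NgL _] := sg.
have gE : (fun x => - (\- g) x) = g by apply/funext => x /=; rewrite opprK.
have gL : g \in L2 by have := L2N NgL; rewrite gE.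
by exists g; split => //; apply: L2_derivative_right => //; exact: ltW.
Qed.

Lemma ge0_sq_integral0_ae f : f \in L2 -> \int[mu]_x (f x ^+ 2) <= 0 ->
  {ae mu, forall x, f x = 0}.
Proof.
move=> fL f0; have fI := L2_sq_integrable fL; have mf := measurable_int _ fI.
have I0 : (\int[mu]_x `|(f x ^+ 2)%:E| = 0)%E.
  have -> : (\int[mu]_x `|(f x ^+ 2)%:E| = \int[mu]_x (f x ^+ 2)%:E)%E.
    by apply: eq_integral => x _; rewrite gee0_abs// lee_fin sqr_ge0.
  apply/eqP; rewrite eq_le integral_ge0 ?andbT; last first.
    by move=> x _; rewrite lee_fin sqr_ge0.
  by rewrite -(fineK (integrable_fin_num measurableT fI)) lee_fin.
have /(ae_eq_integral_abs mu measurableT mf) := I0.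
apply: filterS => x /(_ I) /eqP; rewrite /= eqe sqrf_eq0.
by move=> /eqP.
Qed.

(** The squared norm of the positive part of [w1 - w2] decreases, since the
    subdifferential is monotone when paired with that positive part. *)
Lemma L2_semigroup_comparison s p v1 v2 w1 w2 t : 1 <= p ->
  L2_semigroup s p v1 w1 -> L2_semigroup s p v2 w2 ->
  {ae mu, forall x, v1 x <= v2 x} -> 0 <= t ->
  {ae mu, forall x, w1 t x <= w2 t x}.
Proof.
move=> p1 S1 S2 v12 t0.
have C1 := L2_semigroup_curve S1; have C2 := L2_semigroup_curve S2.
have CD := L2_curveB C1 C2.
have [w1L _ _] := C1; have [w2L _ _] := C2; have [DL _ _] := CD.
have pL u : 0 <= u -> pospart (fun x => w1 u x - w2 u x) \in L2.
  by move=> u0; apply: L2_pospart; exact: DL.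
have decr := L2_curve_pospart_le CD t0.
have start : \int[mu]_x (pospart (fun x => w1 0 x - w2 0 x) x ^+ 2) = 0.
  have [i1 _ _ _ _] := S1; have [i2 _ _ _ _] := S2.
  rewrite /Rintegral (ae_eq_integral (cst 0%E)) ?integral0//.
    exact: (measurable_int _ (L2_sq_integrable (pL _ (lexx 0)))).
  apply: filterS3 i1 i2 v12 => x /(_ I) e1 /(_ I) e2 v12x _ /=.
  rewrite /pospart e1 e2 (_ : Num.max _ _ = 0) ?expr0n//.
  by apply/max_idPr; rewrite subr_le0.
rewrite start in decr.
have : {ae mu, forall x, pospart (fun x => w1 t x - w2 t x) x = 0}.
  apply: ge0_sq_integral0_ae; first exact: pL.
  apply: decr.
  have d1 := L2_semigroup_right_derivative S1.
  have d2 := L2_semigroup_right_derivative S2.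
  apply: (@filterS2 _ _ (ae_filter_ringOfSetsType _) _ _ _ _ d1 d2).
  move=> u u1 u2 u0; have [g1 [g1L dg1 sg1]] := u1 u0.
  have [g2 [g2L dg2 sg2]] := u2 u0.
  exists (fun x => g1 x - g2 x); split; first exact: L2B.
    by apply: L2_right_derivativeB => //; exact: ltW.
  have := subdifferential_T_monotone p1 sg1 sg2.
  have dgL := L2B g1L g2L.
  rewrite -[X in X <= 0]opprK oppr_le0 -mulN1r -RintegralZl//; last first.
    by apply: L2_mul_integrable => //; apply: pL; exact: ltW.
  congr (_ <= _); apply: eq_Rintegral => x _.
  by rewrite mulN1r -mulrN; congr (_ * _); ring.
apply: filterS => x; rewrite /pospart => /eqP.
by rewrite -subr_le0 => /eqP/max_idPr.
Qed.

Lemma L2_semigroup0 s p : p != 0 -> 0 <= p ->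
  L2_semigroup s p (fun _ : E => 0) (fun _ _ => 0).
Proof.
move=> pn0 p0.
have zL : (fun _ : E => 0 : R) \in L2.
  by rewrite inE; apply/andP; split; rewrite inE//= /finite_norm Lnorm0// eqe.
have n0 : norm2 (fun _ : E => (0 - 0)%R) = 0%E :> \bar R.
  rewrite -[RHS](@Lnorm0 _ E R mu 2%:E) ?eqe//; apply: eq_Lnorm => x /=.
  by rewrite subrr.
split => //.
- by apply: filterE.
- by move=> t0 _; rewrite (_ : (fun t => _) = cst 0%E);
    [exact: cvg_cst|apply/funext => t; exact: n0].
- by move=> d d0; exists 0 => t1 t2 _ _; rewrite mul0r n0.
- apply: (@filterE _ _ (ae_filter_ringOfSetsType _)) => t t0; exists (fun=> 0); split.
    rewrite /L2_derivative (_ : (fun h => _) = cst 0%E); first exact: cvg_cst.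
    apply/funext => h; rewrite -[RHS](@Lnorm0 _ E R mu 2%:E) ?eqe//.
    by apply: eq_Lnorm => x /=; rewrite subrr mul0r subrr.
  split => //.
    by rewrite (_ : (\- _) = fun=> 0)//; apply/funext => x /=; rewrite oppr0.
  move=> v vL; rewrite energy0// add0e.
  rewrite integral0_eq ?energy_ge0// => x _.
  by rewrite /= oppr0 mul0r.
Qed.

(** Comparison with the zero orbit. *)
Lemma L2_semigroup_ge0 s p v w t : 1 <= p -> L2_semigroup s p v w ->
  {ae mu, forall x, 0 <= v x} -> 0 <= t -> {ae mu, forall x, 0 <= w t x}.
Proof.
move=> p1 S v0 t0; have p0 : 0 < p by lra.
apply: (L2_semigroup_comparison p1 (L2_semigroup0 s _ (ltW p0)) S v0 t0).
by rewrite gt_eqF.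
Qed.

(** The weighted mass cannot drop faster than a power law, so its value at any
    time is controlled by its value at a later time [T] and by [T]. The
    linearisation level is the one at which the decay rate is [1 / (2 T)]. *)
Lemma L2_semigroup_weighted_le s p v w x0 r T t
    (l := (4 * (nonlocal_const (N := N) (sigma := s * p) * r `^ (- (s * p))) * T)
            `^ (2 - p)^-1)
    (phi := @test_fun R N (s * p) x0 r) :
  (0 < N)%N -> 1 < p < 2 -> 0 < s * p < 1 -> 0 < r -> 0 < T ->
  L2_semigroup s p v w -> {ae mu, forall x, 0 <= v x} -> 0 <= t <= T ->
  \int[mu]_x (phi x * w t x) <=
    2 * \int[mu]_x (phi x * w T x) + l * \int[mu]_x phi x.
Proof.
move=> N0 /andP[p1 p2] sp01 r0 T0 S v0 tT.
have C := L2_semigroup_curve S; have [wL _ _] := C.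
pose B := @nonlocal_const R N (s * p) * r `^ (- (s * p)).
have B0 : 0 < B.
  by rewrite mulr_gt0 ?powR_gt0//; exact: (nonlocal_const_gt0 sp01 N0).
have l0 : 0 < l.
  apply: powR_gt0; rewrite -/B; apply: mulr_gt0 => //.
  by apply: mulr_gt0.
have bound : nonlocal_bound (s * p) B phi.
  by move=> x; exact: (test_fun_nonlocal_le sp01 N0).
have phi0 x : 0 <= phi x by exact: test_fun_ge0.
have phim x : phi x <= r `^ (- (N%:R + s * p)) by exact: (test_fun_le sp01 N0).
have mphi : measurable_fun setT phi by exact: measurable_test_fun.
have phiI : mu.-integrable setT (EFin \o phi) by exact: (test_fun_integrable sp01 N0).
have phiL := L2_of_bounded_integrable mphi phi0 phim phiI.
have W0 : 0 <= \int[mu]_x phi x by exact: Rintegral_ge0.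
apply: (@L2_curve_backward_bound _ _ _ mu w phi T (2 * B * l `^ (p - 2))) => //.
- by apply: mulr_ge0; [apply: mulr_ge0; rewrite // ltW|exact: powR_ge0].
- by apply: mulr_ge0; rewrite // ltW.
- rewrite {1}/l -/B -powRrM (_ : (2 - p)^-1 * (p - 2) = -1); last by field; lra.
  rewrite powR_inv1; last by apply: mulr_ge0; [apply: mulr_ge0|]; rewrite // ltW.
  by rewrite le_eqVlt; apply/orP; left; apply/eqP; field; lra.
- move=> u u0; have pw := L2_mul_integrable phiL (wL _ u0).
  have w0 := L2_semigroup_ge0 (ltW p1) S v0 u0.
  have -> : \int[mu]_x (phi x * w u x) = \int[mu]_x (phi x * `|w u x|).
    congr fine; apply: ae_eq_integral => //; first exact: measurable_int _ pw.
      apply/measurable_EFinP; apply: measurable_funM => //.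
      by apply: measurableT_comp => //; exact: L2_measurable (wL _ u0).
    by apply: filterS w0 => x wx _; rewrite /= ger0_norm.
  by apply: Rintegral_ge0 => x _; rewrite mulr_ge0.
- have d := L2_semigroup_right_derivative S.
  apply: (@filterS _ _ (ae_filter_ringOfSetsType _) _ _ _ d) => u du u0.
  have [g [gL dg sg]] := du u0; exists g; split => //.
  have p12 : 1 < p <= 2 by rewrite p1 ltW.
  have phib x : 0 <= phi x <= r `^ (- (N%:R + s * p)) by rewrite phi0 phim.
  have := subdifferential_pairing_le p12 (ltW B0) l0 sg
    (L2_semigroup_ge0 (ltW p1) S v0 (ltW u0)) phiL phib bound phiI.
  rewrite lerNl; congr (_ <= _).
  rewrite -mulN1r -RintegralZl//; last exact: L2_mul_integrable.
  by apply: eq_Rintegral => x _; rewrite mulrN mulN1r.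
Qed.

End semigroup.

(** * Passage to the limit in weighted masses *)

Section weighted_mass.
Context d (T : measurableType d) (R : realType).
Variable mu : {measure set T -> \bar R}.
Context (phi : T -> R) (m : R) (mphi : measurable_fun setT phi)
  (phi0 : forall x, 0 <= phi x) (phim : forall x, phi x <= m)
  (phiI : mu.-integrable setT (EFin \o phi)).
Implicit Types (F G H : T -> \bar R) (f : T -> R).

Definition wmass F : \bar R := (\int[mu]_x ((phi x)%:E * `|F x|))%E.

Let mE : measurable_fun setT (EFin \o phi). Proof. exact/measurable_EFinP. Qed.

Lemma measurable_wmass F : measurable_fun setT F ->
  measurable_fun setT (fun x => ((phi x)%:E * `|F x|)%E).
Proof. by move=> mF; apply: emeasurable_funM => //; exact: measurableT_comp. Qed.

Lemma wmass_integrand_ge0 F x : (0 <= (phi x)%:E * `|F x|)%E.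
Proof. by rewrite mule_ge0 ?lee_fin. Qed.

Lemma ae_eq_wmass F G : measurable_fun setT F -> measurable_fun setT G ->
  {ae mu, forall x, F x = G x} -> wmass F = wmass G.
Proof.
move=> mF mG FG; apply: ae_eq_integral => //; try exact: measurable_wmass.
by apply: filterS FG => x Fx _; rewrite Fx.
Qed.

Lemma wmass_triangle F G H : measurable_fun setT F -> measurable_fun setT G ->
  measurable_fun setT H -> (forall x, (`|F x| <= `|G x| + `|H x|)%E) ->
  (wmass F <= wmass G + wmass H)%E.
Proof.
move=> mF mG mH tri; rewrite /wmass -ge0_integralD//.
- apply: ge0_le_integral => //.
  + by move=> x _; exact: wmass_integrand_ge0.
  + exact: measurable_wmass.
  + by apply: emeasurable_funD; exact: measurable_wmass.
  + by move=> x _; rewrite -ge0_muleDr//; apply: lee_wpmul2l; rewrite ?lee_fin.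
- by move=> x _; exact: wmass_integrand_ge0.
- exact: measurable_wmass.
- by move=> x _; exact: wmass_integrand_ge0.
- exact: measurable_wmass.
Qed.

Lemma wmass_fatou (f : nat -> T -> R) F M : (forall n, measurable_fun setT (f n)) ->
  measurable_fun setT F -> {ae mu, forall x, (f n x)%:E @[n --> \oo] --> F x} ->
  (forall n, (wmass (EFin \o f n) <= M)%E) -> (wmass F <= M)%E.
Proof.
move=> mf mF fF fM.
pose g n x := ((phi x)%:E * `|(f n x)%:E|)%E.
have mg n : measurable_fun setT (g n).
  by apply: measurable_wmass; exact/measurable_EFinP.
have g0 n x : setT x -> (0 <= g n x)%E by move=> _; rewrite mule_ge0 ?lee_fin.
apply: (@le_trans _ _ (\int[mu]_x (limn_einf (g ^~ x)))%E).
  apply: ae_ge0_le_integral => //.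
  - by move=> x _; exact: wmass_integrand_ge0.
  - exact: measurable_wmass.
  - move=> x _; rewrite limn_einf_lim; apply: lime_ge; first exact: is_cvg_einfs.
    by apply: nearW => n; apply: le_ereal_inf_tmp => _ [k _ <-]; exact: g0.
  - apply: measurableT_comp => //.
    by apply: measurable_fun_limn_esup => n; exact: measurableT_comp.
  - apply: filterS fF => x fx _.
    have gx : g n x @[n --> \oo] --> ((phi x)%:E * `|F x|)%E.
      by apply: cvgeZl => //; exact: cvg_abse.
    rewrite is_cvg_limn_einfE; last by apply/cvg_ex; eexists; exact: gx.
    by rewrite (cvg_lim _ gx).
apply: (le_trans (fatou mu measurableT mg g0)).
rewrite limn_einf_lim; apply: lime_le; first exact: is_cvg_einfs.
apply: nearW => n; apply: le_trans (fM n).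
by apply: ereal_inf_lbound; exists n => /=.
Qed.

(** Elementary substitute for Hoelder's inequality that treats [q = 1] in the same
    way as [q > 1]: below the level [e] the function is bounded by [e], above it by
    a multiple of its [q]-th power. *)
Lemma abse_le_powere (e q : R) (x : \bar R) : 0 < e -> 1 <= q ->
  (`|x| <= e%:E + (e `^ (1 - q))%:E * `|x| `^ q)%E.
Proof.
move=> e0 q1; have q0 : 0 < q by lra.
have c0 : 0 < e `^ (1 - q) by exact: powR_gt0.
case: x => [x| |] /=; last 2 first.
- by rewrite gt_eqF// gt0_muley ?lte_fin//= addey// leey.
- by rewrite gt_eqF// gt0_muley ?lte_fin//= addey// leey.
rewrite -EFinM -EFinD lee_fin.
have [xe|ex] := leP `|x| e; first by rewrite ler_wpDr// mulr_ge0 ?powR_ge0.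
apply: ler_wpDl; first exact: ltW.
have x0 : 0 < `|x| by lra.
have -> : `|x| `^ q = `|x| * `|x| `^ (q - 1) by rewrite mulr_powRB1//; exact: ltW.
rewrite mulrCA ler_peMr//.
rewrite (_ : 1 - q = - (q - 1)); last by ring.
rewrite powRN mulrC ler_pdivlMr ?powR_gt0// mul1r.
by apply: ge0_ler_powR; rewrite ?nnegrE; lra.
Qed.

Lemma wmass_le_of_Lnorm q eta : 1 <= q -> 0 < eta -> exists2 delta : R, 0 < delta &
  forall F, measurable_fun setT F -> ('N[mu]_q%:E[F] < delta%:E)%E ->
    (wmass F <= eta%:E)%E.
Proof.
move=> q1 eta0; have q0 : 0 < q by lra.
pose W := \int[mu]_x phi x; have W0 : 0 <= W by exact: Rintegral_ge0.
have m0 : 0 <= `|m| by [].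
pose e := eta / 2 / (W + 1); have e0 : 0 < e by rewrite /e !divr_gt0//; lra.
have eW : e * W <= eta / 2.
  rewrite /e -mulrA -[leRHS]mulr1; apply: ler_wpM2l; first lra.
  by rewrite mulrC ler_pdivrMr; lra.
pose c := (`|m| + 1) * e `^ (1 - q).
have c0 : 0 < c by rewrite mulr_gt0 ?powR_gt0//; lra.
pose delta := (eta / 2 / c) `^ q^-1.
have d0 : 0 < delta by apply: powR_gt0; rewrite !divr_gt0.
exists delta => // F mF NF.
have mq : measurable_fun setT (fun x => (`|F x| `^ q)%E).
  by apply: (measurableT_comp (measurable_poweR _)); exact: measurableT_comp.
have pq : (\int[mu]_x (`|F x| `^ q) <= (eta / 2 / c)%:E)%E.
  rewrite -poweR_Lnorm ?gt_eqF//.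
  have -> : (eta / 2 / c)%:E = (delta%:E `^ q)%E.
    by rewrite poweR_EFin -powRrM mulVf ?gt_eqF// powRr1// ltW// !divr_gt0.
  apply: gt0_ler_poweR; rewrite ?(ltW q0) ?(ltW NF)//.
    by rewrite in_itv/= Lnorm_ge0 leey.
  by rewrite in_itv/= lee_fin (ltW d0) leey.
have bound x : ((phi x)%:E * `|F x| <= e%:E * (phi x)%:E + c%:E * `|F x| `^ q)%E.
  apply: (@le_trans _ _ ((phi x)%:E * (e%:E + (e `^ (1 - q))%:E * `|F x| `^ q))%E).
    by apply: lee_wpmul2l; [rewrite lee_fin|exact: abse_le_powere].
  rewrite ge0_muleDr ?lee_fin ?(ltW e0)//; last by rewrite mule_ge0 ?lee_fin ?powR_ge0 ?poweR_ge0.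
  rewrite muleC; apply: leeD2l; rewrite muleA; apply: lee_wpmul2r; first exact: poweR_ge0.
  rewrite -EFinM lee_fin; apply: ler_wpM2r; first exact: powR_ge0.
  by apply: (le_trans (phim x)); have := ler_norm m; lra.
have mc : measurable_fun setT (fun x => (c%:E * `|F x| `^ q)%E) by exact: measurable_funeM.
have me : measurable_fun setT (fun x => (e%:E * (phi x)%:E)%E) by exact: measurable_funeM.
apply: (@le_trans _ _ (\int[mu]_x (e%:E * (phi x)%:E + c%:E * `|F x| `^ q))%E).
  apply: ge0_le_integral => //.
  - by move=> x _; exact: wmass_integrand_ge0.
  - exact: measurable_wmass.
  - exact: emeasurable_funD.
rewrite ge0_integralD//; last 2 first.
- by move=> x _; rewrite mule_ge0 ?lee_fin ?(ltW e0).
- by move=> x _; rewrite mule_ge0 ?lee_fin ?(ltW c0) ?poweR_ge0.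
rewrite ge0_integralZl//; last 2 first.
- by move=> x _; rewrite lee_fin.
- by rewrite lee_fin ltW.
rewrite ge0_integralZl//; last 2 first.
- by move=> x _; rewrite poweR_ge0.
- by rewrite lee_fin ltW.
rewrite -(fineK (integrable_fin_num measurableT phiI)) -/(Rintegral mu setT phi) -/W.
have cp : (c%:E * \int[mu]_x (`|F x| `^ q) <= (eta / 2)%:E)%E.
  apply: (@le_trans _ _ (c%:E * (eta / 2 / c)%:E)%E).
    by apply: lee_wpmul2l => //; rewrite lee_fin ltW.
  by rewrite -EFinM lee_fin mulrC divfK ?gt_eqF.
rewrite (_ : eta = eta / 2 + eta / 2); last by field.
by rewrite EFinD leeD// -EFinM lee_fin.
Qed.

Lemma wmass_L2 f : f \in Lfun mu 2%:E -> {ae mu, forall x, 0 <= f x} ->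
  wmass (EFin \o f) = (\int[mu]_x (phi x * f x))%:E.
Proof.
move=> fL f0; have phiL := L2_of_bounded_integrable mphi phi0 phim phiI.
have pfI := L2_mul_integrable phiL fL.
rewrite /Rintegral fineK; last exact: integrable_fin_num.
apply: ae_eq_integral => //.
- by apply: measurable_wmass; apply/measurable_EFinP; exact: L2_measurable fL.
- exact: measurable_int _ pfI.
- by apply: filterS f0 => x fx _ /=; rewrite ger0_norm.
Qed.

End weighted_mass.

(** * Solutions with finite extinction time *)

Section extinction.
Context {R : realType} {N : nat} {s p : R}.
Context (N0 : (0 < N)%N) (p12 : 1 < p < 2) (sp01 : 0 < s * p < 1).
Local Notation E := (N.-tuple R).
Local Notation mu := (@leb R N).
Local Notation phi := (@test_fun R N (s * p)).
Implicit Types (v : E -> R) (w : R -> E -> R) (x : E) (r t T q : R).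

(** The level [l] of linearisation, times a bound for the integral of the weight. *)
Definition weighted_bound r T : R :=
  (4 * (@nonlocal_const R N (s * p) * r `^ (- (s * p))) * T) `^ (2 - p)^-1 *
  (@far_const R N (s * p) * r `^ (- (s * p))).

Let mphi x0 r : measurable_fun setT (phi x0 r).
Proof. exact: measurable_test_fun. Qed.

Let phi0 x0 r x : 0 <= phi x0 r x. Proof. exact: test_fun_ge0. Qed.

Let phim x0 r x : 0 < r -> phi x0 r x <= r `^ (- (N%:R + s * p)).
Proof. by move=> r0; exact: (test_fun_le sp01 N0). Qed.

Let phiI x0 r : 0 < r -> mu.-integrable setT (EFin \o phi x0 r).
Proof. exact: (test_fun_integrable sp01 N0). Qed.

Lemma L2_semigroup_wmass_le v w x0 r T t : 0 < r -> 0 < T ->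
  L2_semigroup s p v w -> {ae mu, forall x, (0 <= v x)%R} -> 0 <= t <= T ->
  (wmass mu (phi x0 r) (EFin \o w t) <=
   2%:E * wmass mu (phi x0 r) (EFin \o w T) + (weighted_bound r T)%:E)%E.
Proof.
move=> r0 T0 S v0 /[dup] tT /andP[t0 _].
have /andP[p1 p2] := p12.
have [wL _ _] := L2_semigroup_curve S.
have pm x := phim x0 x r0.
have wE := wmass_L2 (mphi x0 r) (phi0 x0 r) pm (phiI x0 r0).
have ge t' : 0 <= t' -> {ae mu, forall x, 0 <= w t' x}.
  by move=> t'0; apply: (L2_semigroup_ge0 (ltW p1) S v0).
rewrite (wE _ (wL _ t0) (ge _ t0)) (wE _ (wL _ (ltW T0)) (ge _ (ltW T0))).
rewrite -EFinM -EFinD lee_fin.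
apply: (le_trans (L2_semigroup_weighted_le x0 N0 p12 sp01 r0 T0 S v0 tT)).
rewrite lerD2l; apply: ler_wpM2l; first exact: powR_ge0.
have := test_fun_integral_le sp01 N0 x0 r0.
by rewrite -(fineK (integrable_fin_num measurableT (phiI x0 r0))) lee_fin.
Qed.

Let mEFin v : measurable_fun setT v -> measurable_fun setT (EFin \o v).
Proof. by move=> mv; exact/measurable_EFinP. Qed.

Lemma wmass_ae0 x0 r (F : E -> \bar R) : measurable_fun setT F ->
  F = cst 0%E %[ae mu] -> wmass mu (phi x0 r) F = 0%E.
Proof.
move=> mF F0; rewrite (ae_eq_wmass (G := cst 0%E) (mphi x0 r))//.
  by rewrite /wmass integral0_eq// => x _; rewrite abse0 mule0.
by apply: filterS F0 => x /(_ I).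
Qed.

(** In [L^q] the weighted masses converge, so that the bound for the approximating
    orbits survives with the terminal mass tending to zero. *)
Lemma Lq_solution_wmass_le q (u0 : E -> R) (u : R -> E -> \bar R) x0 r T : 1 <= q -> 0 < r -> 0 < T ->
  Lq_solution s p q u0 u -> (forall t, 0 <= t -> measurable_fun setT (u t)) ->
  measurable_fun setT u0 -> u T = cst 0%E %[ae mu] ->
  (forall t, 0 <= t <= T -> (wmass mu (phi x0 r) (u t) <= (weighted_bound r T)%:E)%E) /\
  (wmass mu (phi x0 r) (EFin \o u0) <= (weighted_bound r T)%:E)%E.
Proof.
move=> q1 r0 T0 [_ [v [w [vP S vu0 wu]]]] mu_t mu0 uT0.
have pm x := phim x0 x r0.
have wL n t : 0 <= t -> measurable_fun setT (w n t).
  by move=> t0; have [wL _ _] := L2_semigroup_curve (S n); exact: L2_measurable (wL _ t0).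
have uT : wmass mu (phi x0 r) (u T) = 0%E.
  by apply: wmass_ae0 => //; apply: mu_t; exact: ltW.
have close eta (F : nat -> E -> \bar R) : 0 < eta ->
    (forall n, measurable_fun setT (F n)) ->
    ('N[mu]_q%:E[F n])%E @[n --> \oo] --> 0%E ->
    \forall n \near \oo, (wmass mu (phi x0 r) (F n) <= eta%:E)%E.
  move=> eta0 mF NF.
  have [d d0 hd] := wmass_le_of_Lnorm (mphi x0 r) (phi0 x0 r) pm (phiI x0 r0) q1 eta0.
  have NFd : \forall n \near \oo, ('N[mu]_q%:E[F n] < d%:E)%E.
    exact: cvge0_near_lt NF d0.
  by apply: filterS NFd => n; exact: hd.
have mdiff n t : 0 <= t -> measurable_fun setT ((EFin \o w n t) \- u t)%E.
  by move=> t0; apply: emeasurable_funB; [apply: mEFin; exact: wL|exact: mu_t].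
have combine (x y : \bar R) (W e : R) :
    (x <= 2%:E * y + W%:E)%E -> (y <= e%:E)%E -> (x <= (W + 2 * e)%:E)%E.
  move=> + ye => /le_trans; apply; rewrite (EFinD W) (EFinM 2 e) addeC.
  by apply: leeD2r; apply: lee_wpmul2l; rewrite ?lee_fin.
have abs_le_r (a : R) (y : \bar R) : (`|a%:E| <= `|y| + `|a%:E - y|)%E.
  case: y => [y| |]; rewrite ?leey//.
  rewrite -[leRHS]/((`|y| + `|a - y|)%:E) lee_fin.
  by rewrite -{1}(subrK y a) addrC ler_normD.
have abs_le_l (a : R) (y : \bar R) : (`|y| <= `|a%:E| + `|a%:E - y|)%E.
  case: y => [y| |]; rewrite ?leey//.
  rewrite -[leRHS]/((`|a| + `|a - y|)%:E) lee_fin.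
  by rewrite -{1}(subKr a y) ler_normB.
have bound_n n t eta : 0 <= t <= T ->
    (wmass mu (phi x0 r) ((EFin \o w n T) \- u T)%E <= eta%:E)%E ->
    (wmass mu (phi x0 r) (EFin \o w n t) <= (weighted_bound r T + 2 * eta)%:E)%E.
  move=> tT wT; have [v0 _ _] := vP n.
  apply: (combine _ _ _ _ (L2_semigroup_wmass_le x0 r0 T0 (S n) v0 tT)).
  have : (wmass mu (phi x0 r) (EFin \o w n T) <= wmass mu (phi x0 r) (u T) +
      wmass mu (phi x0 r) ((EFin \o w n T) \- u T))%E.
    apply: (wmass_triangle mu (mphi x0 r) (phi0 x0 r)).
    + by apply: mEFin; apply: wL; exact: ltW.
    + by apply: mu_t; exact: ltW.
    + by apply: mdiff; exact: ltW.
    + by move=> x; exact: abs_le_r.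
  by rewrite uT add0e => /le_trans; exact.
have closeT eta : 0 < eta -> \forall n \near \oo,
    (wmass mu (phi x0 r) ((EFin \o w n T) \- u T)%E <= eta%:E)%E.
  move=> eta0; apply: close => //; last exact: wu (ltW T0).
  by move=> n; apply: mdiff; exact: ltW.
split.
- move=> t /[dup] tT /andP[t0 _]; apply/lee_addgt0Pr => e e0.
  have e3 : 0 < e / 3 by lra.
  have closet : \forall n \near \oo,
      (wmass mu (phi x0 r) ((EFin \o w n t) \- u t)%E <= (e / 3)%:E)%E.
    by apply: close => //; [move=> n; exact: mdiff|exact: wu].
  have [n [nT nt]] := filter_ex (filterI (closeT _ e3) closet).
  apply: (@le_trans _ _ (wmass mu (phi x0 r) (EFin \o w n t) +
      wmass mu (phi x0 r) ((EFin \o w n t) \- u t))%E).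
    apply: (wmass_triangle mu (mphi x0 r) (phi0 x0 r)).
    + exact: mu_t.
    + by apply: mEFin; exact: wL.
    + exact: mdiff.
    + by move=> x; exact: abs_le_l.
  apply: (le_trans (leeD (bound_n _ _ _ tT nT) nt)).
  by rewrite -!EFinD lee_fin; lra.
- apply/lee_addgt0Pr => e e0; have e3 : 0 < e / 3 by lra.
  have mv n : measurable_fun setT (v n).
    by have [_ /andP[+ _] _] := vP n; rewrite inE.
  have mvu n : measurable_fun setT (EFin \o (v n \- u0)).
    by apply: mEFin; exact: measurable_funB.
  have [n [nT nt]] := filter_ex (filterI (closeT _ e3) (close _ _ e3 mvu vu0)).
  have tT : (0 : R) <= 0 <= T by apply/andP; split => //; exact: ltW.
  apply: (@le_trans _ _ (wmass mu (phi x0 r) (EFin \o v n) +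
      wmass mu (phi x0 r) (EFin \o (v n \- u0)%R))%E).
    apply: (wmass_triangle mu (mphi x0 r) (phi0 x0 r)) => //; try exact: mEFin.
    by move=> x /=; rewrite lee_fin -{1}(subKr (v n x) (u0 x)) ler_normB.
  have <- : wmass mu (phi x0 r) (EFin \o w n 0) = wmass mu (phi x0 r) (EFin \o v n).
    apply: (ae_eq_wmass (mphi x0 r)); [by apply: mEFin; exact: wL|exact: mEFin|].
    by have [i _ _ _ _] := S n; apply: filterS i => x /(_ I) /= ->.
  apply: (le_trans (leeD (bound_n _ _ _ tT nT) nt)).
  by rewrite -!EFinD lee_fin; lra.
Qed.

(** For a monotone approximation, order preservation forces every approximating
    orbit to be extinct at time [T] as well. *)
Lemma minimal_solution_wmass_le (u0 : E -> R) (u : R -> E -> \bar R) x0 r T : 0 < r -> 0 < T ->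
  minimal_solution s p u0 u -> (forall t, 0 <= t -> measurable_fun setT (u t)) ->
  measurable_fun setT u0 -> u T = cst 0%E %[ae mu] ->
  (forall t, 0 <= t <= T -> (wmass mu (phi x0 r) (u t) <= (weighted_bound r T)%:E)%E) /\
  (wmass mu (phi x0 r) (EFin \o u0) <= (weighted_bound r T)%:E)%E.
Proof.
move=> r0 T0 [v [w [vP mono vu0 S wu]]] mu_t mu0 uT0.
have /andP[p1 _] := p12.
have wL n t : 0 <= t -> measurable_fun setT (w n t).
  by move=> t0; have [wL _ _] := L2_semigroup_curve (S n); exact: L2_measurable (wL _ t0).
have wT n : wmass mu (phi x0 r) (EFin \o w n T) = 0%E.
  apply: wmass_ae0; first by apply: mEFin; apply: wL; exact: ltW.
  have [v0 _ _] := vP n.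
  have w0 := L2_semigroup_ge0 (ltW p1) (S n) v0 (ltW T0).
  have order : {ae mu, forall x, forall k, w n T x <= w (n + k)%N T x}.
    apply: ae_foralln => k.
    apply: (L2_semigroup_comparison (ltW p1) (S n) (S (n + k)%N)); last exact: ltW.
    by apply: filterS mono => x; apply; exact: leq_addr.
  have limT := wu _ (ltW T0).
  have ae4 := @filterI _ _ (ae_filter_ringOfSetsType mu) _ _ limT uT0.
  apply: filterS3 w0 order ae4 => x wx ox [lx ux] _ /=.
  move: lx; rewrite (ux I) /= => lx.
  congr EFin; apply/eqP; rewrite eq_le wx andbT -lee_fin.
  apply: (cvge_ge (F := \oo)) lx; exists n => // k /= nk.
  by rewrite lee_fin -(subnKC nk).
have bound n t : 0 <= t <= T ->
    (wmass mu (phi x0 r) (EFin \o w n t) <= (weighted_bound r T)%:E)%E.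
  move=> tT; have [v0 _ _] := vP n.
  have := L2_semigroup_wmass_le x0 r0 T0 (S n) v0 tT.
  by rewrite wT mule0 add0e.
split.
- move=> t /[dup] tT /andP[t0 _].
  apply: (wmass_fatou (mphi x0 r) (phi0 x0 r) (f := fun n => w n t)).
  + by move=> n; exact: wL.
  + exact: mu_t.
  + exact: wu.
  + by move=> n; exact: bound.
- have mv n : measurable_fun setT (v n).
    by have [_ /andP[+ _] _] := vP n; rewrite inE.
  apply: (wmass_fatou (mphi x0 r) (phi0 x0 r) mv); first exact: mEFin.
    apply: filterS vu0 => x vx; apply/fine_cvgP; split; last exact: vx.
    exact: nearW.
  move=> n; have <- : wmass mu (phi x0 r) (EFin \o w n 0) =
      wmass mu (phi x0 r) (EFin \o v n).
    apply: (ae_eq_wmass (mphi x0 r)); [by apply: mEFin; exact: wL|exact: mEFin|].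
    by have [i _ _ _ _] := S n; apply: filterS i => x /(_ I) /= ->.
  by apply: bound; rewrite lexx ltW.
Qed.

Lemma measurable_eucl_ball x0 r : measurable (eucl_ball x0 r).
Proof.
rewrite (_ : eucl_ball x0 r = setT `&` eucl_dist x0 @^-1` `]-oo, r[).
  apply: (measurableT_comp measurable_eucl_dist (pair1_measurable x0)) => //.
by apply/seteqP; split => y /=; rewrite in_itv/= => -[].
Qed.

Lemma ball_integral_le_wmass x0 r (F : E -> \bar R) : 0 < r ->
  measurable_fun setT F ->
  (\int[mu]_(x in eucl_ball x0 r) `|F x| <=
   ((N.+1%:R * r) `^ (N%:R + s * p))%:E * wmass mu (phi x0 r) F)%E.
Proof.
move=> r0 mF; set k := _ `^ _.
have k0 : 0 < k by rewrite powR_gt0// mulr_gt0.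
have mw := measurable_wmass (mphi x0 r) mF.
have w0 x := wmass_integrand_ge0 (phi0 x0 r) F x.
rewrite /wmass -ge0_integralZl//; last by rewrite lee_fin ltW.
have mkw : measurable_fun setT (fun x => (k%:E * ((phi x0 r x)%:E * `|F x|))%E).
  exact: measurable_funeM.
have kw0 x : (0 <= k%:E * ((phi x0 r x)%:E * `|F x|))%E.
  by rewrite mule_ge0// lee_fin ltW.
have mB := measurable_eucl_ball x0 r.
apply: (@le_trans _ _ (\int[mu]_(x in eucl_ball x0 r)
    (k%:E * ((phi x0 r x)%:E * `|F x|)))%E); last first.
  by apply: ge0_subset_integral.
apply: ge0_le_integral => //.
- by apply: measurableT_comp => //; exact: measurable_funS mF.
- exact: measurable_funS mkw.
- move=> x xB; rewrite muleA -EFinM -[leLHS]mul1e; apply: lee_wpmul2r => //.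
  rewrite lee_fin /test_fun powRN.
  have d0 : 0 < r + l1_dist x0 x by have := l1_dist_ge0 x0 x; lra.
  rewrite ler_pdivlMr ?powR_gt0// mul1r.
  have a0 : 0 <= N%:R + s * p by rewrite addr_ge0// ltW//; case/andP: sp01.
  apply: ge0_ler_powR; rewrite ?nnegrE ?(ltW d0)//.
    by rewrite mulr_ge0// ltW.
  rewrite -natr1 mulrDl mul1r addrC lerD2r.
  apply: (le_trans (l1_dist_le_eucl x0 x)); apply: ler_wpM2l => //.
  exact: ltW.
Qed.

End extinction.

(** Both powers of [r] combine into the Morrey exponent
    [N * (q - 1) / q = N - s * p / (2 - p)], and the constant depends on [N], [s]
    and [p] only. *)
Lemma weighted_bound_scaling (R : realType) (N : nat) (s p r T : R)
    (q := N%:R * (2 - p) / (s * p)) :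
  (0 < N)%N -> 1 < p < 2 -> 0 < s * p < 1 -> 0 < r -> 0 <= T ->
  (N.+1%:R * r) `^ (N%:R + s * p) * weighted_bound (N := N) (s := s) (p := p) r T =
  N.+1%:R `^ (N%:R + s * p) * (4 * @nonlocal_const R N (s * p)) `^ (2 - p)^-1 *
    @far_const R N (s * p) * T `^ (1 / (2 - p)) * r `^ (N%:R * (q - 1) / q).
Proof.
move=> N0 /andP[p1 p2] /[dup] sp01 /andP[sp0 sp1] r0 T0.
have Np : 0 < N%:R :> R by rewrite ltr0n.
have nc := nonlocal_const_gt0 sp01 N0; rewrite /weighted_bound.
set K := nonlocal_const in nc *; set F := far_const.
set k := (2 - p)^-1; set a := N%:R + s * p.
have rs0 : 0 <= r `^ (- (s * p)) by exact: powR_ge0.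
rewrite (_ : 4 * (K * r `^ (- (s * p))) * T = 4 * K * (r `^ (- (s * p)) * T));
  last by ring.
rewrite (powRM _ (ltW (ltr0Sn R N)) (ltW r0)).
rewrite (powRM k (mulr_ge0 (ler0n R 4) (ltW nc)) (mulr_ge0 rs0 T0)).
rewrite (powRM k rs0 T0) -(powRrM r) div1r -/k.
have -> : r `^ (N%:R * (q - 1) / q) =
    r `^ a * (r `^ (- (s * p) * k) * r `^ (- (s * p))).
  rewrite -!powRD ?(gt_eqF r0) ?implybT//; congr (_ `^ _).
  rewrite /q /a /k; move: (s * p) sp0 => sigma sigma0.
  by field; lra.
ring.
Qed.

Theorem proposition8p3 (R : realType) (N : nat) (s p : R)
    (hN : (2 <= N)%N) (hs : 0 < s < 1)
    (hp : 1 < p < 2 * N%:R / (N%:R + s)) (hsp : s * p < 1) :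
  let qstar := N%:R * (2 - p) / (s * p) in
  exists C : R,
    forall (u0 : N.-tuple R -> R) (u : R -> N.-tuple R -> \bar R) (T : R),
      loc_integrable (EFin \o u0) ->
      {ae @leb R N, forall x, 0 <= u0 x} ->
      solution s p u0 u ->
      0 < T ->
      extinction_time u T ->
      (forall t : R, 0 <= t <= T -> morrey_space qstar (u t)) /\
      (morrey_norm qstar (EFin \o u0) <= (C * T `^ (1 / (2 - p)))%:E)%E.
Proof.
move=> qstar.
have N0 : (0 < N)%N by exact: ltnW.
have /andP[s0 s1] := hs; have /andP[p1 pc] := hp.
have Np : 0 < N%:R :> R by rewrite ltr0n.
have p2 : p < 2.
  apply: (lt_trans pc); rewrite ltr_pdivrMr ?addr_gt0// ltr_pM2l//.
  by rewrite ltrDl.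
have p12 : 1 < p < 2 by rewrite p1.
have sp01 : 0 < s * p < 1 by rewrite hsp andbT mulr_gt0//; lra.
exists (N.+1%:R `^ (N%:R + s * p) * (4 * @nonlocal_const R N (s * p)) `^ (2 - p)^-1 *
  @far_const R N (s * p)).
move=> u0 u T [mu0 _] _ [mu_t sol] T0 [[_ vanish] _].
have uT0 := vanish T (lexx T).
have mu0R : measurable_fun setT u0 by exact/measurable_EFinP.
set C := (X in X * _).
have main (F : N.-tuple R -> \bar R) : measurable_fun setT F ->
    (forall x0 r, 0 < r -> (wmass (@leb R N) (@test_fun R N (s * p) x0 r) F <=
      (weighted_bound (N := N) (s := s) (p := p) r T)%:E)%E) ->
    morrey_bound qstar F (C * T `^ (1 / (2 - p))).
  move=> mF wF x0 r r0; apply: (le_trans (ball_integral_le_wmass sp01 x0 r0 mF)).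
  rewrite -(weighted_bound_scaling N0 p12 sp01 r0 (ltW T0)) EFinM.
  by apply: lee_wpmul2l; [rewrite lee_fin powR_ge0|exact: wF].
have both x0 r : 0 < r ->
    (forall t, 0 <= t <= T -> (wmass (@leb R N) (@test_fun R N (s * p) x0 r) (u t) <=
      (weighted_bound (N := N) (s := s) (p := p) r T)%:E)%E) /\
    (wmass (@leb R N) (@test_fun R N (s * p) x0 r) (EFin \o u0) <=
      (weighted_bound (N := N) (s := s) (p := p) r T)%:E)%E.
  move=> r0; case: sol => [[q q1 solq]|solm].
    exact: (Lq_solution_wmass_le N0 p12 sp01 x0 q1 r0 T0 solq).
  exact: (minimal_solution_wmass_le N0 p12 sp01 x0 r0 T0 solm).
split.
- move=> t /[dup] tT /andP[t0 _].
  have mF := mu_t t t0.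
  have Cb : morrey_bound qstar (u t) (C * T `^ (1 / (2 - p))).
    by apply: main => // x0 r r0; have [h _] := both x0 r r0; exact: h.
  split; last by exists (C * T `^ (1 / (2 - p))).
  split=> // x0 r r0; apply/integrableP; split; first exact: measurable_funS mF.
  exact: le_lt_trans (Cb x0 r r0) (ltry _).
- apply: ereal_inf_lbound; exists (C * T `^ (1 / (2 - p))) => //.
  by apply: main => // x0 r r0; have [_ h] := both x0 r r0.
Qed.
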